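(* Let $\Bbbk$ be a field, let $Q=\Bbbk[[x,y,z]]$ be the power series ring in three variables, and consider the following ideals in $Q$: $$\begin{aligned} \mathfrak{g}_1 &= (xy^2,\; xyz,\; yz^2,\; x^4-y^3z,\; xz^3-y^4),\\ \mathfrak{g}_2 &= \mathfrak{g}_1 + (x^3y-z^4),\\ \mathfrak{g}_3 &= \mathfrak{g}_2 + (x^2z^2),\\ \mathfrak{g}_4 &= \mathfrak{g}_3 + (x^3z). \end{aligned}$$ Then for each $n\in\{1,2,3,4\}$ the local ring $Q/\mathfrak{g}_n$ has embedding codepth $3$ and type $2$, and $Q/\mathfrak{g}_n$ belongs to the class $\mathbf{G}(n+1)$.
   Context: Let $R$ be a commutative noetherian local ring with maximal ideal $\mathfrak{m}$ and residue field $k=R/\mathfrak{m}$. The embedding dimension $e$ of $R$ is the minimal number of generators of $\mathfrak{m}$; with $d$ the depth of $R$, the embedding codepth of $R$ is $e-d$. The type of $R$ is $\operatorname{rank}_k \operatorname{Ext}_R^d(k,R)$; for a ring of depth $0$ this is the $k$-vector space dimension of the socle $(0:\mathfrak{m})$. Suppose $R=Q/I$ has embedding codepth $3$, where $Q$ is a complete regular local ring with residue field $k$ and with the same embedding dimension as $R$. The minimal free resolution of $R$ over $Q$ has the form $$F \;=\; 0 \to Q^n \to Q^m \to Q^{l+1} \to Q \to 0,$$ where $n$ is the type of $R$, $l+1=\mu(I)$ is the minimal number of generators of $I$, and $m=n+l$. It carries a structure of a graded-commutative differential graded algebra (Buchsbaum–Eisenbud), and the induced graded-commutative $k$-algebra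 structure on $A=\operatorname{H}(F\otimes_Q k)=\operatorname{Tor}^Q_*(R,k)$ is unique up to isomorphism. The graded algebra $A$ is isomorphic to the homology algebra $\operatorname{H}(K^R)$ of the Koszul complex $K^R$ on a minimal set of generators of $\mathfrak{m}$. Graded-commutativity means that, for $\mathbf{e}_i,\mathbf{e}_j\in A_1$ and $\mathbf{f}_j\in A_2$, one has $\mathbf{e}_i\mathbf{e}_j=-\mathbf{e}_j\mathbf{e}_i$, $\mathbf{e}_i^2=0$, and $\mathbf{e}_i\mathbf{f}_j=\mathbf{f}_j\mathbf{e}_i$. Class $\mathbf{G}(r)$, for an integer $r\ge 2$: the ring $R$ belongs to $\mathbf{G}(r)$ if there exist $k$-bases $\mathbf{e}_1,\dots,\mathbf{e}_{l+1}$ of $A_1$, $\mathbf{f}_1,\dots,\mathbf{f}_m$ of $A_2$, and $\mathbf{g}_1,\dots,\mathbf{g}_n$ of $A_3$ such that $\mathbf{e}_i\mathbf{f}_i=\mathbf{g}_1$ for all $1\le i\le r$, and all other products of these basis elements that are not determined by these equalities via graded-commutativity are zero. (In particular $A_1\cdot A_1=0$.) *)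

(* Defs.v *)
From HB Require Import structures.
From mathcomp Require Import all_boot all_algebra.
From mathcomp Require Import boolp.

Set Implicit Arguments.
Unset Strict Implicit.
Unset Printing Implicit Defensive.

Import GRing.Theory.
Local Open Scope ring_scope.

Record series (R : Type) := Series { coefs : nat -> R }.

HB.instance Definition _ (R : Type) := [isNew for @coefs R].
HB.instance Definition _ (R : choiceType) := [Choice of series R by <:].

Section SeriesRing.
Variable R : comNzRingType.
Implicit Types f g h : series R.

Lemma seriesP f g : coefs f =1 coefs g -> f = g.
Proof. by case: f g => [f] [g] /= /funext ->. Qed.

Definition constS (a : R) : series R :=
  Series (fun n => if n is 0 then a else 0).
Definition varS : series R := Series (fun n => (n == 1)%:R).

Definition zeroS : series R := Series (fun=> 0).
Definition oppS f : series R := Series (fun n => - coefs f n).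
Definition addS f g : series R := Series (fun n => coefs f n + coefs g n).
Definition mulS f g : series R :=
  Series (fun n => \sum_(i < n.+1) coefs f i * coefs g (n - i)).

Fact addSA : associative addS.
Proof. by move=> f g h; apply: seriesP => n /=; rewrite addrA. Qed.
Fact addSC : commutative addS.
Proof. by move=> f g; apply: seriesP => n /=; rewrite addrC. Qed.
Fact add0S : left_id zeroS addS.
Proof. by move=> f; apply: seriesP => n /=; rewrite add0r. Qed.
Fact addNS : left_inverse zeroS oppS addS.
Proof. by move=> f; apply: seriesP => n /=; rewrite addNr. Qed.

HB.instance Definition _ :=
  GRing.isZmodule.Build (series R) addSA addSC add0S addNS.

Definition truncS (N : nat) f : {poly R} := \poly_(i < N) coefs f i.

Fact coef_mulS (N : nat) f g (n : nat) : (n < N)%N ->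
  coefs (mulS f g) n = (truncS N f * truncS N g)`_n.
Proof.
move=> ltnN; rewrite coefM /=; apply: eq_bigr => i _.
have le_in : (i <= n)%N by rewrite -ltnS.
rewrite !coef_poly (leq_ltn_trans le_in ltnN).
by rewrite (leq_ltn_trans (leq_subr _ _) ltnN).
Qed.

Fact mulSC : commutative mulS.
Proof.
by move=> f g; apply: seriesP => n; rewrite !(@coef_mulS n.+1) // mulrC.
Qed.

Fact mulSA : associative mulS.
Proof.
move=> f g h; apply: seriesP => n.
have trM u v (j : nat) : (j < n.+1)%N ->
    (truncS n.+1 (mulS u v))`_j = (truncS n.+1 u * truncS n.+1 v)`_j.
  by move=> ltj; rewrite coef_poly ltj (@coef_mulS n.+1).
rewrite !(@coef_mulS n.+1) //.
transitivity ((truncS n.+1 f * (truncS n.+1 g * truncS n.+1 h))`_n).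
  rewrite !coefM; apply: eq_bigr => i _.
  by rewrite trM // ltnS leq_subr.
by rewrite mulrA !coefM; apply: eq_bigr => i _; rewrite trM.
Qed.

Fact mul1S : left_id (constS 1) mulS.
Proof.
move=> f; apply: seriesP => n /=.
rewrite big_ord_recl /= mul1r subn0 big1 ?addr0 // => i _.
by rewrite mul0r.
Qed.

Fact mulSDl : left_distributive mulS addS.
Proof.
move=> f g h; apply: seriesP => n /=; rewrite -big_split.
by apply: eq_bigr => i _; rewrite mulrDl.
Qed.

Fact oneS_neq0 : constS 1 != 0.
Proof.
apply/eqP => /(congr1 (fun f => coefs f 0)) /= /eqP.
by rewrite oner_eq0.
Qed.

HB.instance Definition _ := GRing.Zmodule_isComNzRing.Build (series R)
  mulSA mulSC mul1S mulSDl oneS_neq0.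

End SeriesRing.

Definition idealgen (R : comNzRingType) (s : seq R) (a : R) : Prop :=
  exists c : nat -> R, a = \sum_(i < size s) c i * s`_i.

Section LocalRings.
Variable R : comNzRingType.

Definition nonunit (a : R) : Prop := ~ exists b, a * b = 1.

Definition is_ideal (I : R -> Prop) : Prop :=
  [/\ I 0, forall a b, I a -> I b -> I (a + b) & forall a b, I b -> I (a * b)].

(* In the definitions below R is meant to be local, its maximal ideal m being
   the set of nonunits and its residue field being k = R/m. *)
Definition local_ring : Prop := is_ideal nonunit.

Definition generates_max (s : seq R) : Prop :=
  forall a, nonunit a <-> idealgen s a.

Definition is_edim (e : nat) : Prop :=
  (exists2 s, generates_max s & size s = e) /\
  (forall s, generates_max s -> (e <= size s)%N).

(* The requirement R/(s) <> 0 holds because the s_i lie in m. *)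
Definition regular_seq (s : seq R) : Prop :=
  (forall a, a \in s -> nonunit a) /\
  (forall i a, (i < size s)%N ->
     idealgen (take i s) (s`_i * a) -> idealgen (take i s) a).

Definition is_depth (d : nat) : Prop :=
  (exists2 s, regular_seq s & size s = d) /\
  (forall s, regular_seq s -> (size s <= d)%N).

Definition embcodepth (c : nat) : Prop :=
  exists e d, [/\ is_edim e, is_depth d & e = (c + d)%N].

(* For submodules B <= Z of M such that m Z <= B: the classes of the v_i form
   a basis of Z/B as a vector space over R/m. *)
Definition residue_basis (M : lmodType R) (Z B : M -> Prop)
    (t : nat) (v : 'I_t -> M) : Prop :=
  [/\ forall i, Z (v i),
      forall z, Z z -> exists c : 'I_t -> R, B (z - \sum_i c i *: v i)
    & forall c : 'I_t -> R, B (\sum_i c i *: v i) -> forall i, nonunit (c i)].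

(* R^(b N.+1) -> ... -> R^(b 1) -> R^(b 0) -> k -> 0 is the beginning of a free
   resolution of k, exact at R^(b i) for i <= N, where R^(b i) is the module of
   row vectors on which D acts on the right; the augmentation sends v to the
   class of v *m a modulo m.  The D i with N < i are irrelevant. *)
Definition residue_resolution (N : nat) (b : nat -> nat)
    (D : forall i, 'M[R]_(b i.+1, b i)) (a : 'cV[R]_(b 0)) : Prop :=
  [/\ forall r : R, exists v : 'rV[R]_(b 0), nonunit ((v *m a) 0 0 - r),
      forall v : 'rV[R]_(b 0),
        nonunit ((v *m a) 0 0) <-> exists w, v = w *m D 0
    & forall i (v : 'rV[R]_(b i.+1)), (i < N)%N ->
        v *m D i = 0 <-> exists w, v = w *m D i.+1].

(* Hom(R^(b i), R) is identified with column vectors, so that the differential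
   of Hom(F, R) is left multiplication by D. *)
Definition ext_cocycle (b : nat -> nat) (D : forall i, 'M[R]_(b i.+1, b i))
    (i : nat) (u : 'cV[R]_(b i)) : Prop := D i *m u = 0.

Definition ext_coboundary (b : nat -> nat) (D : forall i, 'M[R]_(b i.+1, b i))
    (i : nat) : 'cV[R]_(b i) -> Prop :=
  match i with
  | 0 => fun u => u = 0
  | j.+1 => fun u => exists w : 'cV[R]_(b j), u = D j *m w
  end.

(* Ext^i(k, R) = H^i(Hom(F, R)) depends on F only through degree i + 1. *)
Definition rank_ext (i t : nat) : Prop :=
  exists b D a, @residue_resolution i b D a /\
    exists v : 'I_t -> 'cV[R]_(b i),
      residue_basis (@ext_cocycle b D i) (@ext_coboundary b D i) v.

Definition has_type (t : nat) : Prop := exists2 d, is_depth d & rank_ext d t.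

End LocalRings.

(* For Q local with maximal ideal m and an ideal I, a minimal free resolution
     0 -> Q^n -d3-> Q^(n+l) -d2-> Q^(l+1) -d1-> Q -> Q/I -> 0
   with a structure of graded-commutative DG algebra.  The Q^b are modules of row
   vectors on which the matrices act on the right.  By graded commutativity the
   product is determined by mul11 : F_1 x F_1 -> F_2 and
   mul12 : F_1 x F_2 -> F_3; leib13 and leib22 are the Leibniz rule for products
   landing in F_4 = 0. *)
Record dg_resolution (Q : comNzRingType) (I : {pred Q}) := DGResolution {
  dg_l : nat;
  dg_n : nat;
  d1 : 'cV[Q]_dg_l.+1;
  d2 : 'M[Q]_(dg_n + dg_l, dg_l.+1);
  d3 : 'M[Q]_(dg_n, dg_n + dg_l);
  mul11 : 'rV[Q]_dg_l.+1 -> 'rV[Q]_dg_l.+1 -> 'rV[Q]_(dg_n + dg_l);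
  mul12 : 'rV[Q]_dg_l.+1 -> 'rV[Q]_(dg_n + dg_l) -> 'rV[Q]_dg_n;
  exact0 : forall q, q \in I <-> exists a : 'rV_dg_l.+1, q = (a *m d1) 0 0;
  exact1 : forall a : 'rV_dg_l.+1, a *m d1 = 0 <-> exists f, a = f *m d2;
  exact2 : forall f : 'rV_(dg_n + dg_l), f *m d2 = 0 <-> exists g, f = g *m d3;
  exact3 : forall g : 'rV_dg_n, g *m d3 = 0 -> g = 0;
  minimal1 : forall i j, nonunit (d1 i j);
  minimal2 : forall i j, nonunit (d2 i j);
  minimal3 : forall i j, nonunit (d3 i j);
  linear11l : forall b, linear (mul11^~ b);
  linear11r : forall a, linear (mul11 a);
  linear12l : forall f, linear (mul12^~ f);
  linear12r : forall a, linear (mul12 a);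
  sqr1 : forall a, mul11 a a = 0;
  assoc111 : forall a b c, mul12 c (mul11 a b) = mul12 a (mul11 b c);
  leib11 : forall a b,
    mul11 a b *m d2 = (a *m d1) 0 0 *: b - (b *m d1) 0 0 *: a;
  leib12 : forall a f,
    mul12 a f *m d3 = (a *m d1) 0 0 *: f - mul11 a (f *m d2);
  leib13 : forall a (g : 'rV_dg_n), 0 = (a *m d1) 0 0 *: g - mul12 a (g *m d3);
  leib22 : forall f h, 0 = mul12 (f *m d2) h + mul12 (h *m d2) f
}.

Arguments mul11 {Q I} _ _ _.
Arguments mul12 {Q I} _ _ _.

Section ClassG.
Variable Q : comNzRingType.

(* The submodule m Q^b of Q^b. *)
Definition max_mul (b : nat) (v : 'rV[Q]_b) : Prop := forall j, nonunit (v 0 j).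

(* The classes of the v_i form a basis of Q^b / m Q^b over k. *)
Definition tensor_basis (b t : nat) (v : 'I_t -> 'rV[Q]_b) : Prop :=
  residue_basis (fun=> True) (@max_mul b) v.

(* Q is meant to be a complete regular local ring of the same embedding
   dimension as Q/I.  F being minimal, A = H(F tensor k) is F tensor k = F/mF;
   its elements are given by representatives in F.  Products of total degree
   at least 4 vanish, as A_i = 0 for i > 3. *)
Definition class_G (I : idealr Q) (r : nat) : Prop :=
  [/\ embcodepth {ideal_quot I} 3, (2 <= r)%N &
    exists (F : dg_resolution I)
        (ee : 'I_(dg_l F).+1 -> 'rV[Q]_(dg_l F).+1)
        (ff : 'I_(dg_n F + dg_l F) -> 'rV[Q]_(dg_n F + dg_l F))
        (gg : 'I_(dg_n F) -> 'rV[Q]_(dg_n F)) (i1 : 'I_(dg_n F)),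
      [/\ [/\ i1 = 0%N :> nat, (r <= (dg_l F).+1)%N & (r <= dg_n F + dg_l F)%N],
          [/\ tensor_basis ee, tensor_basis ff & tensor_basis gg],
          forall i j, max_mul (mul11 F (ee i) (ee j))
        & forall i j, max_mul (mul12 F (ee i) (ff j)
            - (if (i == j :> nat) && (i < r)%N then gg i1 else 0))]].

End ClassG.

Section Ideals.
Variable k : fieldType.

(* k[[x]][[y]][[z]]: an element is a function nat -> nat -> nat -> k, and the
   product is the convolution over exponents in nat^3. *)
Definition Q : comNzRingType := series (series (series k)).

Definition x : Q := constS (constS (varS k)).
Definition y : Q := constS (varS (series k)).
Definition z : Q := varS (series (series k)).

Definition gens1 : seq Q :=
  [:: x * y ^+ 2; x * y * z; y * z ^+ 2; x ^+ 4 - y ^+ 3 * z;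
      x * z ^+ 3 - y ^+ 4].
Definition gens2 := gens1 ++ [:: x ^+ 3 * y - z ^+ 4].
Definition gens3 := gens2 ++ [:: x ^+ 2 * z ^+ 2].
Definition gens4 := gens3 ++ [:: x ^+ 3 * z].

Definition gens (n : nat) : seq Q :=
  match n with 1 => gens1 | 2 => gens2 | 3 => gens3 | _ => gens4 end.

Definition ideal_g (n : nat) : {pred Q} := fun q => `[< idealgen (gens n) q >].

Definition const_term (q : Q) : k := coefs (coefs (coefs q 0) 0) 0.

Fact const_term_zmod : zmod_morphism const_term.
Proof. by []. Qed.

Fact const_term_monoid : monoid_morphism const_term.
Proof.
by split=> [|p q]; rewrite /const_term //= !big_ord1 /= !big_ord1 /= !big_ord1.
Qed.

HB.instance Definition _ :=
  GRing.isZmodMorphism.Build Q k const_term const_term_zmod.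
HB.instance Definition _ :=
  GRing.isMonoidMorphism.Build Q k const_term const_term_monoid.

Fact const_term_gens n q : q \in gens n -> const_term q = 0.
Proof.
have g4 : all (fun p => const_term p == 0) gens4.
  have : [/\ const_term x = 0, const_term y = 0 & const_term z = 0] by [].
  rewrite /gens4 /gens3 /gens2 /gens1.
  have -> : const_term = (const_term : {rmorphism Q -> k}) by [].
  move: x y z (const_term : {rmorphism Q -> k}) => u v w c [cu cv cw].
  move: Q u v w c cu cv cw => A u v w c cu cv cw /=.
  rewrite !(rmorphB, rmorphM, rmorphXn) /= cu cv cw !expr0n /=.
  by rewrite !(mul0r, mulr0, subrr) !eqxx.
move/allP: g4 => g4 qin; apply/eqP/g4; move: qin.
have sub s1 s2 : {subset s1 <= s1 ++ s2 :> seq Q}.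
  by move=> p pin; rewrite mem_cat pin.
by case: n => [|[|[|[|n]]]] qin //; do ![exact: qin | apply: (sub)].
Qed.

Fact ideal_g_closed n : idealr_closed (ideal_g n).
Proof.
split.
- apply/asboolP; exists (fun=> 0); rewrite big1 // => i _.
  by rewrite mul0r.
- apply/asboolP => -[c] /(congr1 const_term) /eqP; apply/negP.
  rewrite rmorph1 rmorph_sum big1 ?oner_eq0 // => i _.
  rewrite rmorphM; apply/eqP; rewrite mulf_eq0; apply/orP; right; apply/eqP.
  exact: (const_term_gens (mem_nth 0 (ltn_ord i))).
- move=> a u v /asboolP[c ->] /asboolP[c' ->]; apply/asboolP.
  exists (fun i => a * c i + c' i); rewrite mulr_sumr -big_split /=.
  by apply: eq_bigr => i _; rewrite mulrDl mulrA.
Qed.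

HB.instance Definition _ n := isIdealr.Build Q (ideal_g n) (ideal_g_closed n).

Definition quot_g (n : nat) : comNzRingType := {ideal_quot (ideal_g n)}.

End Ideals.

Arguments ideal_g : clear implicits.

(* Main.v *)
Require Import Defs.
From mathcomp Require Import all_boot all_algebra.
From mathcomp Require Import ring boolp.

(* Explicit matrices give a complex F of free modules with a product that
   satisfies the Leibniz rule, and multiplication by an element of F_1 is a
   homotopy, so that the homology of F in positive degrees is annihilated by the
   ideal.  The ideal contains x^5, y^5 and, for n > 1, z^5; these form a regular
   sequence, whence F is acyclic.  The ideal g_1 contains no power of z, but z^5
   still annihilates H_1, as after inverting z the ideal is generated by the
   regular sequence y z^2, x z^3 - y^4.  The socle of Q/I is isomorphic to
   F_3/mF_3, by a zigzag through the tensor product of F with the Koszul complex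
   of x, y, z.  Hence it has rank 2; as it is not zero, the depth is 0. *)

Set Implicit Arguments.
Unset Strict Implicit.
Unset Printing Implicit Defensive.

Import GRing.Theory.
Local Open Scope ring_scope.
Local Open Scope quotient_scope.

(** * Regular sequences and acyclicity *)

(** Acyclicity is an elementwise form of the acyclicity lemma: for a regular sequence [X, Y, Z],
    annihilation by [X] handles [H_3], annihilation by [X] and [Y] handles [H_2], and only [H_1]
    calls for all three. Hence the missing power of [z] in g_1 matters in degree 1 alone. All
    matrices and products have integer coefficients, so each identity is decided once, by
    computation with polynomials over the integers, and then holds over any field [k]. Associativity
    and the Leibniz rule for two elements of degree 2 are not computed: they follow from the
    injectivity of the last differential. As the resolution is minimal, the algebra [A] is read off
    from the constant terms of the multiplication matrices, and the pairing of class G consists of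
    the entries equal to 1. The embedding dimension is 3 because no generator has a monomial of
    degree less than 2. The homological part works over any ring with suitable quotient operators by
    [x], [y], [z]; power series enter only at the end, as an instance. *)

Definition regular3 (R : comNzRingType) (X Y Z : R) : Prop :=
  [/\ forall u, X * u = 0 -> u = 0,
      forall u v, Y * u = X * v -> exists w, u = X * w
    & forall u v w, Z * w = X * u + Y * v -> exists s t, w = X * s + Y * t].

Section RegularRows.
Variables (R : comNzRingType) (X Y Z : R) (b : nat).
Hypothesis regXYZ : regular3 X Y Z.
Implicit Types u v w : 'rV[R]_b.

Lemma regular_row1 u : X *: u = 0 -> u = 0.
Proof.
have [reg _ _] := regXYZ => /rowP u0; apply/rowP => j; rewrite mxE.
by apply: reg; have := u0 j; rewrite !mxE.
Qed.

Lemma row_exists (P : 'I_b -> R -> Prop) :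
  (forall j, exists c, P j c) -> exists w, forall j, P j (w 0 j).
Proof.
by case/fin_all_exists => f fP; exists (\row_j f j) => j; rewrite mxE.
Qed.

Lemma regular_row2 u v : Y *: u = X *: v -> exists w, u = X *: w.
Proof.
have [_ reg _] := regXYZ => /rowP uv.
have [j|w wP] := @row_exists (fun j c => u 0 j = X * c).
  by apply: (reg _ (v 0 j)); have := uv j; rewrite !mxE.
by exists w; apply/rowP => j; rewrite mxE.
Qed.

Lemma regular_row3 u v w :
  Z *: w = X *: u + Y *: v -> exists s t, w = X *: s + Y *: t.
Proof.
have [_ _ reg] := regXYZ => /rowP uv.
have [j|s sP] := @row_exists (fun j c => exists d, w 0 j = X * c + Y * d).
  by apply: (reg (u 0 j) (v 0 j)); have := uv j; rewrite !mxE.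
have [t tP] := row_exists sP.
by exists s, t; apply/rowP => j; rewrite !mxE.
Qed.

(** Exactness in degree 1 of the Koszul complex of [X, Y, Z] with coefficients in [R^b]: [p, q, r]
    are the coefficients of the three Koszul relations. *)
Lemma koszul1 u v w : X *: u + Y *: v + Z *: w = 0 ->
  exists p q r,
    [/\ u = Y *: p + Z *: q, v = Z *: r - X *: p & w = - (X *: q) - Y *: r].
Proof.
move=> uvw0.
have [|s [t wE]] := @regular_row3 (- u) (- v) w.
  by rewrite !scalerN; apply/esym/eqP; rewrite -opprD eqr_oppLR -addr_eq0 uvw0.
have [|h vE] := @regular_row2 (v + Z *: t) (- (u + Z *: s)).
  apply/eqP; rewrite -subr_eq0 -uvw0 wE; apply/eqP/rowP => j.
  by rewrite !mxE; ring.
have uE : u + Z *: s + Y *: h = 0.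
  apply: regular_row1; rewrite -uvw0 wE; apply/rowP => j.
  have /rowP/(_ j) := vE; rewrite !mxE => /(canRL (addrK _)) ->; ring.
exists (- h), (- s), (- t); split.
- apply/rowP => j; have /rowP/(_ j) := uE; rewrite !mxE => /eqP.
  by rewrite -addrA addr_eq0 => /eqP ->; ring.
- rewrite -[v in LHS](addrK (Z *: t)) vE.
  by apply/rowP => j; rewrite !mxE; ring.
- by rewrite wE; apply/rowP => j; rewrite !mxE; ring.
Qed.

(** Exactness of the same Koszul complex in degree 2; the two equations imply [Z *: v = Y *: w], as
    [X] can be cancelled. *)
Lemma koszul2 u v w : Y *: u = X *: v -> Z *: u = X *: w ->
  exists h, [/\ u = X *: h, v = Y *: h & w = Z *: h].
Proof.
move=> uv uw; have [h uE] := regular_row2 uv; exists h; split=> //.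
  by apply/eqP; rewrite -subr_eq0; apply/eqP/regular_row1;
    rewrite scalerBr -uv uE !scalerA mulrC subrr.
by apply/eqP; rewrite -subr_eq0; apply/eqP/regular_row1;
  rewrite scalerBr -uw uE !scalerA mulrC subrr.
Qed.

End RegularRows.

Section Acyclicity.
Variables (R : comNzRingType) (X Y Z : R) (b1 b2 b3 : nat).
Variables (d1 : 'cV[R]_b1) (d2 : 'M[R]_(b2, b1)) (d3 : 'M[R]_(b3, b2)).
Hypothesis regXYZ : regular3 X Y Z.
Hypothesis d32 : d3 *m d2 = 0.
Hypothesis kill3 : forall g : 'rV_b3, g *m d3 = 0 -> X *: g = 0.
Hypothesis kill2 : forall f : 'rV_b2, f *m d2 = 0 ->
  (exists g, X *: f = g *m d3) /\ (exists g, Y *: f = g *m d3).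
Hypothesis kill1 : forall a : 'rV_b1, a *m d1 = 0 ->
  [/\ exists f, X *: a = f *m d2, exists f, Y *: a = f *m d2
    & exists f, Z *: a = f *m d2].

Lemma acyclic3 (g : 'rV_b3) : g *m d3 = 0 -> g = 0.
Proof. by move/kill3/(regular_row1 regXYZ). Qed.

(** Lifts [u], [v] of [X *: f], [Y *: f] satisfy [Y *: u = X *: v] because [d3] is injective. So [u]
    is divisible by [X], and cancelling [X] exhibits [f] as a boundary. *)
Lemma acyclic2 (f : 'rV_b2) : f *m d2 = 0 -> exists g, f = g *m d3.
Proof.
case/kill2 => -[u fu] [v fv].
have [|w uE] := @regular_row2 _ X Y Z _ regXYZ u v.
  apply/eqP; rewrite -subr_eq0; apply/eqP/acyclic3.
  by rewrite mulmxBl -!scalemxAl -fu -fv !scalerA mulrC subrr.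
exists w; apply/eqP; rewrite -subr_eq0; apply/eqP/(regular_row1 regXYZ).
by rewrite scalerBr fu uE scalemxAl subrr.
Qed.

Lemma acyclic1 (a : 'rV_b1) : a *m d1 = 0 -> exists f, a = f *m d2.
Proof.
case/kill1 => -[u au] [v av] [w aw].
(* The cross differences of the three lifts are cycles in [F_2], hence boundaries of some [p], [q],
   [r]. *)
have [|p pE] := @acyclic2 (Y *: u - X *: v).
  by rewrite mulmxBl -!scalemxAl -au -av !scalerA mulrC subrr.
have [|q qE] := @acyclic2 (Z *: u - X *: w).
  by rewrite mulmxBl -!scalemxAl -au -aw !scalerA mulrC subrr.
have [|r rE] := @acyclic2 (Z *: v - Y *: w).
  by rewrite mulmxBl -!scalemxAl -av -aw !scalerA mulrC subrr.
(* Injectivity of [d3] gives [Z *: p - Y *: q + X *: r = 0]. Writing [p] through [X] and [Y] yields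
   the boundary by which [u] must be corrected to become divisible by [X]. *)
have [|s [t pst]] := @regular_row3 _ X Y Z _ regXYZ (- r) q p.
  apply/eqP; rewrite -subr_eq0; apply/eqP/acyclic3.
  rewrite scalerN mulmxBl mulmxDl mulNmx -!scalemxAl -pE -qE -rE.
  by apply/rowP => j; rewrite !mxE; ring.
have [|h uE] := @regular_row2 _ X Y Z _ regXYZ (u - t *m d3) (v + s *m d3).
  apply/eqP; rewrite -subr_eq0; apply/eqP; move: pE; rewrite pst.
  rewrite mulmxDl -!scalemxAl => /eqP; rewrite -subr_eq0 => /eqP <-.
  by apply/rowP => j; rewrite !mxE; ring.
exists h; apply/eqP; rewrite -subr_eq0; apply/eqP/(regular_row1 regXYZ).
rewrite scalerBr au scalemxAl -uE mulmxBl -mulmxA d32 mulmx0 subr0.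
by rewrite subrr.
Qed.

End Acyclicity.

(* The zigzag through the tensor product of the Koszul complex of [x, y, z] with
   the resolution, which computes the isomorphism of the socle of [Q / I] with
   [F_3 / m F_3]. *)
Section Zigzag.
Variables (R : comNzRingType) (x y z : R) (b1 b2 b3 : nat).
Variables (d1 : 'cV[R]_b1) (d2 : 'M[R]_(b2, b1)) (d3 : 'M[R]_(b3, b2)).
Hypothesis regxyz : regular3 x y z.
Hypothesis exact1 : forall a : 'rV_b1, a *m d1 = 0 <-> exists f, a = f *m d2.
Hypothesis exact2 : forall f : 'rV_b2, f *m d2 = 0 <-> exists g, f = g *m d3.
Hypothesis exact3 : forall g : 'rV_b3, g *m d3 = 0 -> g = 0.
Implicit Types (q : 'rV[R]_1) (g : 'rV[R]_b3).

(** With [K] the Koszul complex of [x, y, z]: [q] lies in [K_3] tensor [F_0], [(a, b, c)] in [K_2]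
    tensor [F_1], [(p, s, r)] in [K_1] tensor [F_2] and [g] in [K_0] tensor [F_3]. Each group of
    equations matches the Koszul differential of one with the differential of [F] on the next, up to
    sign. It is a relation because the lifts involve choices. *)
Definition zigzag q g : Prop :=
  exists (a b c : 'rV_b1) (p s r : 'rV_b2),
    [/\ [/\ x *: q = a *m d1, y *: q = b *m d1 & z *: q = c *m d1],
        [/\ y *: a - x *: b = p *m d2, z *: a - x *: c = s *m d2
          & z *: b - y *: c = r *m d2]
      & z *: p - y *: s + x *: r = g *m d3].

Lemma zigzag0 : zigzag 0 0.
Proof.
by exists 0, 0, 0, 0, 0, 0; rewrite !(scaler0, mul0mx, subr0, addr0).
Qed.

Lemma zigzagD t q g q' g' :
  zigzag q g -> zigzag q' g' -> zigzag (t *: q + q') (t *: g + g').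
Proof.
move=> [a [b [c [p [s [r [[q1 q2 q3] [p1 p2 p3] gE]]]]]]].
move=> [a' [b' [c' [p' [s' [r' [[q1' q2' q3'] [p1' p2' p3'] gE']]]]]]].
exists (t *: a + a'), (t *: b + b'), (t *: c + c').
exists (t *: p + p'), (t *: s + s'), (t *: r + r').
rewrite !mulmxDl -!scalemxAl -q1 -q2 -q3 -q1' -q2' -q3'.
rewrite -p1 -p2 -p3 -p1' -p2' -p3' -gE -gE'.
by split; [split| split|]; apply/rowP => j; rewrite !mxE; ring.
Qed.

Lemma zigzag_sum (I : finType) (t : I -> R) (q : I -> 'rV_1) (g : I -> 'rV_b3) :
  (forall i, zigzag (q i) (g i)) ->
  zigzag (\sum_i t i *: q i) (\sum_i t i *: g i).
Proof.
move=> qg; elim/big_rec2: _ => [|i u v _]; first exact: zigzag0.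
exact: zigzagD.
Qed.

(** Going down the zigzag uses the exactness of [F]: every Koszul image is a cycle for the
    differential of [F]. *)
Lemma zigzag_from_socle q :
  (exists a, x *: q = a *m d1) -> (exists b, y *: q = b *m d1) ->
  (exists c, z *: q = c *m d1) -> exists g, zigzag q g.
Proof.
move=> [a qa] [b qb] [c qc].
have [|p pE] := (exact1 (y *: a - x *: b)).1.
  by rewrite mulmxBl -!scalemxAl -qa -qb !scalerA mulrC subrr.
have [|s sE] := (exact1 (z *: a - x *: c)).1.
  by rewrite mulmxBl -!scalemxAl -qa -qc !scalerA mulrC subrr.
have [|r rE] := (exact1 (z *: b - y *: c)).1.
  by rewrite mulmxBl -!scalemxAl -qb -qc !scalerA mulrC subrr.
have [|g gE] := (exact2 (z *: p - y *: s + x *: r)).1.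
  rewrite mulmxDl mulmxBl -!scalemxAl -pE -sE -rE.
  by apply/rowP => j; rewrite !mxE; ring.
by exists g, a, b, c, p, s, r.
Qed.

(** Going up the zigzag uses the exactness of the Koszul complex, with coefficients in [F_1] and
    then in [F_0]. Minimality of [F] provides the hypothesis for every [g]. *)
Lemma zigzag_onto g :
  (exists u v w, g *m d3 = x *: u + y *: v + z *: w) -> exists q, zigzag q g.
Proof.
move=> [r [s [p gE]]].
have [|P [Q' [R' [rE sE pE]]]] :=
    @koszul1 _ x y z _ regxyz (r *m d2) (s *m d2) (p *m d2).
  by rewrite !scalemxAl -!mulmxDl -gE; apply: (exact2 _).2; exists g.
have [||q [q1 q2 q3]] := @koszul2 _ x y z _ regxyz
    ((- R') *m d1) (Q' *m d1) ((- P) *m d1).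
- apply/eqP; rewrite -subr_eq0 !scalemxAl -mulmxBl; apply/eqP/exact1.
  by exists p; rewrite pE; apply/rowP => j; rewrite !mxE; ring.
- apply/eqP; rewrite -subr_eq0 !scalemxAl -mulmxBl; apply/eqP/exact1.
  by exists (- s); rewrite mulNmx sE; apply/rowP => j; rewrite !mxE; ring.
exists q, (- R'), Q', (- P), p, (- s), r; split=> //.
  rewrite mulNmx pE sE rE.
  by split; apply/rowP => j; rewrite !mxE; ring.
by rewrite gE; apply/rowP => j; rewrite !mxE; ring.
Qed.

(** A [g] in [m F_3] is a Koszul boundary, and the correction moves up the zigzag by Koszul
    exactness with coefficients in [F_2] and [F_1], until [x] is cancelled in [F_0]. *)
Lemma zigzag_inj q g : zigzag q g ->
  (exists u v w, g = x *: u + y *: v + z *: w) -> exists h, q = h *m d1.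
Proof.
move=> [a [b [c [p [s [r [[q1 q2 q3] [pE sE rE] gE]]]]]]] [u [v [w guvw]]].
have d32 (e : 'rV_b3) : e *m d3 *m d2 = 0 by apply/exact2; exists e.
have [|P [Q' [R' [r' s' p']]]] := @koszul1 _ x y z _ regxyz
    (r - u *m d3) (- s - v *m d3) (p - w *m d3).
  have: z *: p - y *: s + x *: r
       - (x *: (u *m d3) + y *: (v *m d3) + z *: (w *m d3)) = 0.
    by rewrite gE guvw !mulmxDl -!scalemxAl subrr.
  by move=> <-; apply/rowP => j; rewrite !mxE; ring.
have [||h [ha hb hc]] := @koszul2 _ x y z _ regxyz
    (a + R' *m d2) (b - Q' *m d2) (c + P *m d2).
- apply/eqP; rewrite -subr_eq0; apply/eqP.
  transitivity ((p - w *m d3 - (- (x *: Q') - y *: R')) *m d2).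
    rewrite !(mulmxBl, mulNmx) d32 -!scalemxAl -pE.
    by apply/rowP => j; rewrite !mxE; ring.
  by rewrite -p' subrr mul0mx.
- apply/eqP; rewrite -subr_eq0; apply/eqP.
  transitivity ((- (- s - v *m d3 - (z *: R' - x *: P))) *m d2).
    rewrite !(mulmxBl, mulNmx) d32 -!scalemxAl -sE.
    by apply/rowP => j; rewrite !mxE; ring.
  by rewrite -s' subrr oppr0 mul0mx.
exists h; apply/eqP; rewrite -subr_eq0; apply/eqP/(regular_row1 regxyz).
rewrite scalerBr q1 scalemxAl -ha mulmxDl.
by rewrite (_ : _ *m d2 *m d1 = 0) ?addr0 ?subrr //; apply/exact1; exists R'.
Qed.

(** The dual argument: a lift [h] of [q] corrects [a, b, c] and then [p, s, r] by exactness of [F],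
    and the injectivity of [d3] leaves [g] as a combination of [x, y, z]. *)
Lemma zigzag_well_defined q g : zigzag q g ->
  (exists h, q = h *m d1) -> exists u v w, g = x *: u + y *: v + z *: w.
Proof.
move=> [a [b [c [p [s [r [[q1 q2 q3] [pE sE rE] gE]]]]]]] [h hE].
have lift1 t (e : 'rV_b1) : t *: q = e *m d1 ->
    exists f, e - t *: h = f *m d2.
  move=> qe; apply/exact1.
  by rewrite mulmxBl -qe hE -scalemxAl subrr.
have [[f1 f1E] [f2 f2E]] := (lift1 _ _ q1, lift1 _ _ q2).
have [f3 f3E] := lift1 _ _ q3.
have lift2 (t t' : R) (e e' : 'rV_b1) (f f' f0 : 'rV_b2) :
    e - t *: h = f *m d2 -> e' - t' *: h = f' *m d2 ->
    t' *: e - t *: e' = f0 *m d2 ->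
    exists g0, f0 - (t' *: f - t *: f') = g0 *m d3.
  move=> ef ef' ee'; apply/exact2.
  rewrite !mulmxBl -!scalemxAl -ef -ef' -ee'.
  by apply/rowP => j; rewrite !mxE; ring.
have [w wE] := lift2 _ _ _ _ _ _ _ f1E f2E pE.
have [v vE] := lift2 _ _ _ _ _ _ _ f1E f3E sE.
have [u uE] := lift2 _ _ _ _ _ _ _ f2E f3E rE.
exists u, (- v), w; apply/eqP; rewrite -subr_eq0; apply/eqP/exact3.
rewrite mulmxBl !mulmxDl -!scalemxAl mulNmx -gE -uE -vE -wE.
by apply/rowP => j; rewrite !mxE; ring.
Qed.

End Zigzag.

(** * The socle of a quotient of a local ring *)

Section LocalQuotient.
Variables (Q : comNzRingType) (x y z : Q).
Hypothesis nonunitP :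
  forall q : Q, nonunit q <-> exists a b c, q = x * a + y * b + z * c.
Variable I : idealr Q.
Local Notation R := {ideal_quot I}.
Local Notation pi := (\pi_R).

Lemma pi_eq0 q : pi q = 0 <-> q \in I.
Proof.
rewrite -[q in q \in I]subr0 Quotient.idealrBE -(rmorph0 pi).
by split=> [->|/eqP].
Qed.

Lemma pi_surj (r : R) : exists q, r = pi q.
Proof. by exists (repr (r : R)); rewrite reprK. Qed.

Lemma nonunit1 : ~ nonunit (1 : Q).
Proof. by apply; exists 1; rewrite mulr1. Qed.

Lemma nonunit_ideal : is_ideal (@nonunit Q).
Proof.
split=> [|a b /nonunitP[u [v [w ->]]] /nonunitP[u' [v' [w' ->]]]
  |a b nb [c abc]].
- by apply/nonunitP; exists 0, 0, 0; ring.
- by apply/nonunitP; exists (u + u'), (v + v'), (w + w'); ring.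
- by apply: nb; exists (a * c); rewrite -abc; ring.
Qed.

Lemma idealr_nonunit q : q \in I -> nonunit q.
Proof.
move=> qI [b qb1]; have := idealr1 I; rewrite -qb1 mulrC.
by rewrite idealMr.
Qed.

(** Units lift along [pi] because the ideal consists of nonunits: if [q] were a nonunit and
    [q * c - 1] in the ideal, then 1 would be a nonunit. *)
Lemma nonunit_pi q : nonunit (pi q : R) <-> nonunit q.
Proof.
have [n0 nD nM] := nonunit_ideal; split=> nq [b qb1]; last first.
  have [c bE] := pi_surj b; move/eqP: qb1; rewrite bE -rmorphM -(rmorph1 pi).
  rewrite -Quotient.idealrBE => /idealr_nonunit n1.
  apply: nonunit1; rewrite (_ : 1 = c * q + (-1) * (q * c - 1)); last by ring.
  by apply: (nD); apply: nM.
by apply: nq; exists (pi b); rewrite -rmorphM qb1 rmorph1.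
Qed.

Lemma quot_local : local_ring R.
Proof.
have [n0 nD nM] := nonunit_ideal.
split=> [|a b|a b]; first by rewrite -(rmorph0 pi) nonunit_pi.
  have [{}a ->] := pi_surj a; have [{}b ->] := pi_surj b.
  by rewrite -rmorphD !nonunit_pi; apply: nD.
have [{}a ->] := pi_surj a; have [{}b ->] := pi_surj b.
by rewrite -rmorphM !nonunit_pi; apply: nM.
Qed.

Lemma quot_generates_max : generates_max [:: pi x; pi y; pi z].
Proof.
move=> r; have [q ->] := pi_surj r; rewrite nonunit_pi nonunitP; split.
  move=> [a [b [c ->]]]; exists (nth 0 [:: pi a; pi b; pi c]).
  rewrite !big_ord_recl big_ord0 /= addr0 !rmorphD !rmorphM addrA.
  by congr (_ + _ + _); rewrite mulrC.
move=> [c]; rewrite !big_ord_recl big_ord0 /= addr0.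
have [[a ->] [b ->]] := (pi_surj (c 0), pi_surj (c 1)).
have [{}c ->] := pi_surj (c 2); rewrite -!rmorphM -!rmorphD => qE.
apply/nonunitP; apply/nonunit_pi; rewrite qE; apply/nonunit_pi/nonunitP.
by exists a, b, c; ring.
Qed.

Lemma nonunit_row b (g : 'rV[Q]_b) :
  (forall j, nonunit (g 0 j)) <->
  exists u v w, g = x *: u + y *: v + z *: w.
Proof.
split=> [ng|[u [v [w ->]]] j]; last first.
  by apply/nonunitP; exists (u 0 j), (v 0 j), (w 0 j); rewrite !mxE.
have [j|u uP] := @row_exists _ _ (fun j a => exists b c,
    g 0 j = x * a + y * b + z * c); first exact/nonunitP.
have [v vP] := row_exists uP; have [w wP] := row_exists vP.
by exists u, v, w; apply/rowP => j; rewrite !mxE.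
Qed.

Section Socle.
Hypothesis regxyz : regular3 x y z.
Variable F : dg_resolution I.
Local Notation n := (dg_n F).
Local Notation zz := (zigzag x y z (d1 F) (d2 F) (d3 F)).

Lemma mem_ideal (q : 'rV[Q]_1) : q 0 0 \in I <-> exists h, q = h *m d1 F.
Proof.
rewrite (exact0 F); split=> [[h qE]|[h ->]]; exists h => //.
by apply/rowP => j; rewrite !ord1.
Qed.

(** [s i] is a zigzag partner of the i-th basis vector of [F_3]. Spanning follows from [zigzag_inj],
    independence from [zigzag_well_defined]. *)
Lemma socle_basis :
  exists s : 'I_n -> Q,
  [/\ forall i, [/\ x * s i \in I, y * s i \in I & z * s i \in I],
      forall q, x * q \in I -> y * q \in I -> z * q \in I ->
        exists c, q - \sum_i c i * s i \in I
    & forall c, \sum_i c i * s i \in I -> forall i, nonunit (c i)].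
Proof.
have [n0 nD nM] := nonunit_ideal.
have [ex1 ex2 ex3] :=
  And3 (exact1 (d := F)) (exact2 (d := F)) (exact3 (d := F)).
pose e i : 'rV[Q]_n := delta_mx 0 i.
have [i|s sP] := @fin_all_exists 'I_n (fun=> 'rV[Q]_1) (fun i q => zz q (e i)).
  apply: (zigzag_onto regxyz ex1 ex2); apply/nonunit_row => j.
  rewrite mxE; elim/big_ind: _ => // t _; exact/nM/minimal3.
have sE c : (\sum_i c i *: s i) 0 0 = \sum_i c i * s i 0 0.
  by rewrite summxE; apply: eq_bigr => i _; rewrite mxE.
exists (fun i => s i 0 0); split=> [i|q xq yq zq|c].
- have [a [b [c [p [t [r [[q1 q2 q3] _ _]]]]]]] := sP i.
  have eqs t' a' : t' *: s i = a' *m d1 F -> t' * s i 0 0 \in I.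
    by move=> E; have := (mem_ideal _).2 (ex_intro _ a' E); rewrite mxE.
  by split; apply: eqs; [exact: q1 | exact: q2 | exact: q3].
- have lift t : t * q \in I -> exists a, t *: q%:M = a *m d1 F.
    by move=> tq; apply/mem_ideal; rewrite !mxE eqxx mulr1n.
  have [g qg] :=
    zigzag_from_socle ex1 ex2 (lift _ xq) (lift _ yq) (lift _ zq).
  exists (fun i => g 0 i).
  have gE : \sum_i g 0 i *: e i = g by rewrite [RHS]row_sum_delta.
  (* The difference of the two zigzags joins [q] minus the combination of the [s i] to
     [g - g = 0]. *)
  have := zigzagD (-1) (zigzag_sum (fun i => g 0 i) sP) qg.
  rewrite gE !scaleN1r addNr => /(zigzag_inj regxyz ex1 ex2).
  case; first by exists 0, 0, 0; rewrite !scaler0 !addr0.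
  move=> h /(congr1 (fun q : 'rV_1 => q 0 0)) E.
  by apply/(exact0 F); exists h; rewrite -E !mxE sE eqxx mulr1n addrC.
- rewrite -sE => /mem_ideal.
  move=> /(zigzag_well_defined ex1 ex2 ex3 (zigzag_sum c sP)).
  move=> /nonunit_row nc i; have := nc i; rewrite summxE (bigD1 i) //= big1.
    by rewrite addr0 !mxE !eqxx mulr1.
  by move=> j /negPf ji; rewrite !mxE eqxx eq_sym ji mulr0.
Qed.

Lemma quot_rank_ext0 : rank_ext R 0 n.
Proof.
have [s [socs spans frees]] := socle_basis.
(* [Ext^0] depends only on the presentation of [k] by the column of [x, y, z]; its cocycles form the
   socle and its coboundaries vanish. The later differentials are fillers. *)
pose b (i : nat) := (if i is 0 then 1 else 3)%N.
pose D i : 'M[R]_(b i.+1, b i) :=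
  if i is 0 then \col_j [:: pi x; pi y; pi z]`_j else 0.
have DM (u : 'cV[R]_1) : D 0 *m u = 0 <->
    [/\ pi x * u 0 0 = 0, pi y * u 0 0 = 0 & pi z * u 0 0 = 0].
  split=> [/colP Du|[ux uy uz]].
    by have [] := And3 (Du 0) (Du 1) (Du 2); rewrite !mxE !big_ord1 !mxE.
  apply/colP => -[[|[|[|//]]] lt_j]; rewrite !mxE big_ord1 !mxE //.
exists b, D, (const_mx 1); split.
  split=> [r|v|//].
    exists r%:M; rewrite mxE big_ord1 !mxE eqxx mulr1 subrr.
    by have [] := quot_local.
  rewrite [X in nonunit X]mxE big_ord1 [const_mx _ _ _]mxE mulr1.
  rewrite quot_generates_max; split=> [[c cE]|[w ->]].
    exists (\row_j c j); apply/rowP => j; rewrite ord1 cE mxE.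
    by apply: eq_bigr => t _; rewrite !mxE.
  exists (fun j => w 0 (inord j)); rewrite mxE.
  by apply: eq_bigr => t _; rewrite !mxE inord_val.
exists (fun i => (pi (s i))%:M); split=> [i|u /DM[ux uy uz]|c c0 i].
- have [sx sy sz] := socs i; apply/DM; rewrite !mxE eqxx -!rmorphM.
  by split; apply/pi_eq0.
- have [q uE] := pi_surj (u 0 0).
  have [|||c qc] := spans q; try by apply/pi_eq0; rewrite rmorphM /= -uE.
  exists (fun i => pi (c i)); apply/rowP => j; rewrite ord1 !mxE uE summxE.
  transitivity (pi (q - \sum_i c i * s i)); last exact/pi_eq0.
  rewrite rmorphB rmorph_sum; congr (_ - _).
  by apply: eq_bigr => i _; rewrite !mxE eqxx mulr1n rmorphM.
- have [c' c'E] := fin_all_exists (fun i => pi_surj (c i)).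
  rewrite c'E nonunit_pi; apply: (frees c'); apply/pi_eq0.
  rewrite rmorph_sum.
  transitivity ((\sum_i c i *: (pi (s i))%:M : 'cV_1) 0 0).
    rewrite summxE; apply: eq_bigr => j _.
    by rewrite c'E !mxE eqxx mulr1n rmorphM.
  by rewrite [\sum_i _]c0 !mxE.
Qed.

(** A socle element outside the ideal is annihilated by every nonunit, so that no nonunit can start
    a regular sequence. *)
Lemma quot_depth0 : (0 < n)%N -> is_depth R 0.
Proof.
case: n (socle_basis) => // m [s [socs _ frees]] _.
split=> [|[//|t r] [rm reg]]; first by exists [::].
suff s0 : s ord0 \in I.
  have := frees (fun i => (i == ord0)%:R); rewrite (bigD1 ord0) //= big1.
    by rewrite mul1r addr0 => /(_ s0 ord0); rewrite eqxx => /nonunit1.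
  by move=> i /negPf ->; rewrite mul0r.
apply/pi_eq0; have [|c ->] := reg 0%N (pi (s ord0)) isT; last first.
  by rewrite big_ord0.
have /rm : t \in t :: r by rewrite inE eqxx.
have [t' tE] := pi_surj t; rewrite tE nonunit_pi => /nonunitP[a [b [c t'E]]].
exists (fun=> 0); rewrite /= big_ord0 -rmorphM t'E; apply/pi_eq0.
have [sx sy sz] := socs ord0.
have -> : (x * a + y * b + z * c) * s ord0 =
    a * (x * s ord0) + b * (y * s ord0) + c * (z * s ord0) by ring.
by apply: rpredD; first apply: rpredD; apply: idealMr.
Qed.

End Socle.
End LocalQuotient.

(** * Products on a complex of length three *)

(** The two strict triangles cancel. The diagonal has its own hypothesis, as 2 may be zero. *)
Lemma sum_alternating (V : zmodType) b (f : 'I_b -> 'I_b -> V) :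
  (forall i, f i i = 0) -> (forall i j, f i j = - f j i) ->
  \sum_i \sum_j f i j = 0.
Proof.
move=> f0 fN; pose u := \sum_(i < b) \sum_(j < b | (i < j)%N) f i j.
pose v := \sum_(i < b) \sum_(j < b | (j < i)%N) f i j.
have -> : \sum_i \sum_j f i j = u + v.
  rewrite -big_split /=; apply: eq_bigr => i _.
  rewrite (bigID (fun j : 'I_b => (i < j)%N)) /=; congr (_ + _).
  rewrite (bigD1 i) ?ltnn //= f0 add0r; apply: eq_bigl => j.
  by rewrite -leqNgt ltn_neqAle andbC.
have -> : v = - u.
  rewrite /v (exchange_big_dep predT) //= -sumrN; apply: eq_bigr => i _.
  by rewrite -sumrN; apply: eq_bigr => j _; apply: fN.
by rewrite subrr.
Qed.

(* [L i] and [M i] are the matrices of the left multiplications by the basis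
   vector [e_i] of [F_1] on [F_1] and on [F_2]. *)
Section DGProducts.
Variables (Q : comNzRingType) (l n : nat).
Local Notation m := (n + l)%N.
Variables (d1 : 'cV[Q]_l.+1) (d2 : 'M[Q]_(m, l.+1)) (d3 : 'M[Q]_(n, m)).
Variables (L : 'I_l.+1 -> 'M[Q]_(l.+1, m)) (M : 'I_l.+1 -> 'M[Q]_(m, n)).
Hypothesis d21 : d2 *m d1 = 0.
Hypothesis d32 : d3 *m d2 = 0.
Hypothesis L0 : forall i, row i (L i) = 0.
Hypothesis LN : forall i j, row i (L j) = - row j (L i).
Hypothesis L_d2 : forall i, L i *m d2 = (d1 i 0)%:M - d1 *m delta_mx 0 i.
Hypothesis M_d3 : forall i, M i *m d3 = (d1 i 0)%:M - d2 *m L i.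
Hypothesis d3_M : forall i, d3 *m M i = (d1 i 0)%:M.
Implicit Types (a b c : 'rV[Q]_l.+1) (f h : 'rV[Q]_m) (g : 'rV[Q]_n).

Definition prod11 a b : 'rV_m := \sum_i a 0 i *: (b *m L i).
Definition prod12 a f : 'rV_n := \sum_i a 0 i *: (f *m M i).

Lemma prod11_linl b : linear (prod11^~ b).
Proof.
move=> t u v; rewrite /prod11 scaler_sumr -big_split; apply: eq_bigr => i _.
by rewrite !mxE scalerDl scalerA.
Qed.

Lemma prod11_linr a : linear (prod11 a).
Proof.
move=> t u v; rewrite /prod11 scaler_sumr -big_split; apply: eq_bigr => i _.
by rewrite mulmxDl -scalemxAl scalerDr !scalerA mulrC.
Qed.

Lemma prod12_linl f : linear (prod12^~ f).
Proof.
move=> t u v; rewrite /prod12 scaler_sumr -big_split; apply: eq_bigr => i _.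
by rewrite !mxE scalerDl scalerA.
Qed.

Lemma prod12_linr a : linear (prod12 a).
Proof.
move=> t u v; rewrite /prod12 scaler_sumr -big_split; apply: eq_bigr => i _.
by rewrite mulmxDl -scalemxAl scalerDr !scalerA mulrC.
Qed.

Lemma prod11_delta i j : prod11 (delta_mx 0 i) (delta_mx 0 j) = row j (L i).
Proof.
rewrite /prod11 (bigD1 i) //= big1 => [|t /negPf ti]; last first.
  by rewrite mxE ti andbF scale0r.
by rewrite mxE !eqxx scale1r addr0 -rowE.
Qed.

Lemma prod12_delta i j : prod12 (delta_mx 0 i) (delta_mx 0 j) = row j (M i).
Proof.
rewrite /prod12 (bigD1 i) //= big1 => [|t /negPf ti]; last first.
  by rewrite mxE ti andbF scale0r.
by rewrite mxE !eqxx scale1r addr0 -rowE.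
Qed.

Lemma prod11_sqr a : prod11 a a = 0.
Proof.
apply/rowP => s; rewrite summxE [RHS]mxE.
transitivity (\sum_i \sum_j a 0 i * a 0 j * L i j s).
  apply: eq_bigr => i _; rewrite !mxE mulr_sumr.
  by apply: eq_bigr => j _; rewrite mulrA.
apply: sum_alternating => [i|i j].
  by have /rowP/(_ s) := L0 i; rewrite !mxE => ->; rewrite mulr0.
have /rowP/(_ s) := LN j i; rewrite !mxE => ->.
by rewrite mulrN [a 0 j * _]mulrC.
Qed.

Lemma sum_d1 a : \sum_i a 0 i * d1 i 0 = (a *m d1) 0 0.
Proof. by rewrite mxE. Qed.

Lemma prod11_leib a b :
  prod11 a b *m d2 = (a *m d1) 0 0 *: b - (b *m d1) 0 0 *: a.
Proof.
rewrite mulmx_suml -sum_d1 scaler_suml [in X in _ - X](row_sum_delta a).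
rewrite scaler_sumr -sumrB; apply: eq_bigr => i _.
rewrite -scalemxAl -mulmxA L_d2 mulmxBr mul_mx_scalar mulmxA.
rewrite [b *m d1]mx11_scalar mul_scalar_mx !scalerA scalerBr !scalerA.
by congr (_ - _); rewrite mulrC !mxE.
Qed.

Lemma prod12_leib a f :
  prod12 a f *m d3 = (a *m d1) 0 0 *: f - prod11 a (f *m d2).
Proof.
rewrite mulmx_suml -sum_d1 scaler_suml -sumrB; apply: eq_bigr => i _.
rewrite -scalemxAl -mulmxA M_d3 mulmxBr mul_mx_scalar mulmxA.
by rewrite scalerBr !scalerA.
Qed.

Lemma prod13_leib a g : prod12 a (g *m d3) = (a *m d1) 0 0 *: g.
Proof.
rewrite -sum_d1 scaler_suml; apply: eq_bigr => i _.
by rewrite -mulmxA d3_M mul_mx_scalar scalerA.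
Qed.

Lemma prod11C a b : prod11 a b = - prod11 b a.
Proof.
have addl u v w : prod11 (u + v) w = prod11 u w + prod11 v w.
  by have := prod11_linl w 1 u v; rewrite !scale1r.
have addr u v w : prod11 w (u + v) = prod11 w u + prod11 w v.
  by have := prod11_linr w 1 u v; rewrite !scale1r.
have := prod11_sqr (a + b); rewrite addl !addr !prod11_sqr add0r addr0.
by move/eqP; rewrite addr_eq0 => /eqP.
Qed.

Variables X Y Z : Q.
Hypothesis regXYZ : regular3 X Y Z.
Hypothesis XI : exists a : 'rV_l.+1, (a *m d1) 0 0 = X.
Hypothesis YI : exists a : 'rV_l.+1, (a *m d1) 0 0 = Y.
Hypothesis ZK : forall a, a *m d1 = 0 -> exists f : 'rV_m, Z *: a = f *m d2.

(* Multiplication by an element [a] of [F_1] is a homotopy that annihilates the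
   homology by [d1 a]. *)
Lemma kill3 g : g *m d3 = 0 -> X *: g = 0.
Proof.
have [a aX] := XI => g0; rewrite -aX -prod13_leib g0.
by rewrite /prod12 big1 // => i _; rewrite mul0mx scaler0.
Qed.

Lemma kill2 f : f *m d2 = 0 ->
  (exists g : 'rV_n, X *: f = g *m d3) /\ (exists g : 'rV_n, Y *: f = g *m d3).
Proof.
have [[a aX] [b bY]] := (XI, YI) => f0.
have kill c : exists g : 'rV_n, (c *m d1) 0 0 *: f = g *m d3.
  exists (prod12 c f); rewrite prod12_leib f0 /prod11 big1 ?subr0 // => i _.
  by rewrite mul0mx scaler0.
by rewrite -aX -bY; split; apply: kill.
Qed.

(** The homotopy argument for [H_1], in a form that also yields the hypothesis [ZK] when [z ^+ 5]
    lies in the ideal. *)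
Lemma mem_ideal_kill1 c : forall a, a *m d1 = 0 ->
  exists f : 'rV_m, (c *m d1) 0 0 *: a = f *m d2.
Proof.
move=> a a0; exists (prod11 c a).
by rewrite prod11_leib a0 [X in _ - X *: _]mxE scale0r subr0.
Qed.

Lemma kill1 a : a *m d1 = 0 ->
  [/\ exists f : 'rV_m, X *: a = f *m d2, exists f : 'rV_m, Y *: a = f *m d2
    & exists f : 'rV_m, Z *: a = f *m d2].
Proof.
have [[u uX] [v vY]] := (XI, YI) => a0; split; last exact: ZK.
  by rewrite -uX; apply: mem_ideal_kill1.
by rewrite -vY; apply: mem_ideal_kill1.
Qed.

Lemma dg_exact3 g : g *m d3 = 0 -> g = 0.
Proof. exact: acyclic3 regXYZ kill3 g. Qed.

Lemma dg_exact2 f : f *m d2 = 0 <-> exists g, f = g *m d3.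
Proof.
split; first exact: (acyclic2 regXYZ kill3 kill2).
by case=> g ->; rewrite -mulmxA d32 mulmx0.
Qed.

Lemma dg_exact1 a : a *m d1 = 0 <-> exists f, a = f *m d2.
Proof.
split; first exact: (acyclic1 regXYZ d32 kill3 kill2 kill1).
by case=> f ->; rewrite -mulmxA d21 mulmx0.
Qed.

(* The remaining identities may be checked after applying [d3]. *)
Lemma prod111_assoc a b c : prod12 c (prod11 a b) = prod12 a (prod11 b c).
Proof.
apply/eqP; rewrite -subr_eq0; apply/eqP/dg_exact3; rewrite mulmxBl.
have subr u v w : prod11 w (u - v) = prod11 w u - prod11 w v.
  have := prod11_linr w (-1) v u; rewrite !scaleN1r.
  by rewrite ![- _ + _]addrC.
have scaler t u w : prod11 w (t *: u) = t *: prod11 w u.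
  have := prod11_linr w t u 0; rewrite !addr0 => ->.
  by rewrite /prod11 [X in _ + X]big1 ?addr0 // => i _; rewrite mul0mx scaler0.
rewrite !prod12_leib !prod11_leib !subr !scaler [prod11 c b]prod11C.
rewrite [prod11 c a]prod11C.
by apply/rowP => j; rewrite !mxE; ring.
Qed.

Lemma prod22_leib f h : 0 = prod12 (f *m d2) h + prod12 (h *m d2) f.
Proof.
apply/esym/dg_exact3; rewrite mulmxDl !prod12_leib.
rewrite -!mulmxA d21 !mulmx0 mxE !scale0r !sub0r [X in - X + _]prod11C opprK.
by rewrite subrr.
Qed.

Variable I : {pred Q}.
Hypothesis memI : forall q, q \in I <-> exists a : 'rV_l.+1, q = (a *m d1) 0 0.
Hypothesis min1 : forall i j, nonunit (d1 i j).
Hypothesis min2 : forall i j, nonunit (d2 i j).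
Hypothesis min3 : forall i j, nonunit (d3 i j).

Definition dg_of_products : dg_resolution I :=
  DGResolution memI dg_exact1 dg_exact2 dg_exact3 min1 min2 min3
    prod11_linl prod11_linr prod12_linl prod12_linr prod11_sqr prod111_assoc
    prod11_leib prod12_leib
    (fun a g => esym
       (etrans (congr1 (fun u => _ - u) (prod13_leib a g)) (subrr _)))
    prod22_leib.

End DGProducts.

(** The permutation [s] serves to reorder the basis of [A_1] to match that of [A_2]. *)
Lemma tensor_basis_delta (Q : comNzRingType) (b : nat) (s : 'I_b -> 'I_b) :
  nonunit (0 : Q) -> injective s ->
  tensor_basis (fun i => delta_mx 0 (s i) : 'rV[Q]_b).
Proof.
move=> n0 inj_s; have [t sK tK] := injF_bij inj_s.
have sumE (c : 'I_b -> Q) : \sum_i c i *: delta_mx 0 (s i) = \row_j c (t j).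
  rewrite [RHS]row_sum_delta [RHS](reindex_inj inj_s).
  by apply: eq_bigr => i _; rewrite mxE sK.
split=> // [v _|c]; last first.
  by rewrite sumE => nc i; have := nc (s i); rewrite mxE sK.
exists (fun i => v 0 (s i)); rewrite sumE => j.
by rewrite !mxE tK subrr.
Qed.

(** * Coordinates and embedding dimension *)

(* [quox q] is the quotient of [q] by [x], the terms of [q] without [x] being
   dropped; likewise for [quoy] and [quoz]. *)
Record coordinates (k : fieldType) (Q : comNzRingType) (x y z : Q) :=
  Coordinates {
  cst : {rmorphism Q -> k};
  nonunit_cst : forall q, nonunit q <-> cst q = 0;
  nonunit_xyz : forall q,
    nonunit q <-> exists a b c, q = x * a + y * b + z * c;
  quox : Q -> Q;
  quoy : Q -> Q;
  quoz : Q -> Q;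
  quoxD : {morph quox : q r / q + r};
  quoyD : {morph quoy : q r / q + r};
  quozD : {morph quoz : q r / q + r};
  quoxK : forall q, quox (x * q) = q;
  quoxy : forall q, quox (y * q) = y * quox q;
  quoxz : forall q, quox (z * q) = z * quox q;
  quoyx : forall q, quoy (x * q) = x * quoy q;
  quoyK : forall q, quoy (y * q) = q;
  quoyz : forall q, quoy (z * q) = z * quoy q;
  quozx : forall q, quoz (x * q) = x * quoz q;
  quozy : forall q, quoz (y * q) = y * quoz q;
  quozK : forall q, quoz (z * q) = q }.

Section Retraction.
Variables (Q : comNzRingType) (t : Q -> Q) (c : Q).
Implicit Types q r u v : Q.

Lemma iter_retraction e q :
  (forall r, t (c * r) = r) -> iter e t (c ^+ e * q) = q.
Proof.
by move=> tK; elim: e => [|e IHe]; rewrite ?mul1r // iterSr exprS -mulrA tK.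
Qed.

Lemma iter_linear d e q :
  (forall r, t (c * r) = c * t r) ->
  iter d t (c ^+ e * q) = c ^+ e * iter d t q.
Proof.
move=> tc; elim: d => //= d ->; elim: e => [|e IHe]; first by rewrite !mul1r.
by rewrite exprS -!mulrA tc IHe.
Qed.

Lemma iter_additive d :
  {morph t : u v / u + v} -> {morph iter d t : u v / u + v}.
Proof. by move=> tD u v; elim: d => //= d ->. Qed.

Lemma iter_additive0 d : {morph t : u v / u + v} -> iter d t 0 = 0.
Proof.
move=> /(iter_additive d) tD; apply: (addIr (iter d t 0)).
by rewrite -tD !add0r.
Qed.

End Retraction.

Section Coordinates.
Variables (k : fieldType) (Q : comNzRingType) (x y z : Q).
Variable C : coordinates k x y z.
Implicit Types q r u v : Q.
Local Notation cst := (cst C).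
Local Notation quox := (quox C).
Local Notation quoy := (quoy C).
Local Notation quoz := (quoz C).

(** Each quotient operator undoes multiplication by its own variable and commutes with the other
    two. Applied [e] times to a relation, it produces the witnesses. *)
Lemma regular3_exp e : regular3 (x ^+ e) (y ^+ e) (z ^+ e).
Proof.
split=> [u u0|u v uv|u v w uvw].
- rewrite -(iter_retraction e u (quoxK C)) u0 iter_additive0 //.
  exact: quoxD.
- exists (iter e quoy v).
  rewrite -(iter_linear _ _ _ (quoyx C)) -uv iter_retraction //.
  exact: quoyK.
- exists (iter e quoz u), (iter e quoz v).
  rewrite -(iter_linear _ _ _ (quozx C)) -(iter_linear _ _ _ (quozy C)).
  rewrite -iter_additive; last exact: quozD.
  by rewrite -uvw iter_retraction //; apply: quozK.
Qed.

Lemma regular3_xyz : regular3 x y z.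
Proof. by have := regular3_exp 1; rewrite !expr1. Qed.

Lemma y_reg u : y * u = 0 -> u = 0.
Proof.
move=> u0; rewrite -(quoyK C u) u0; exact: (iter_additive0 1 (quoyD C)).
Qed.

Lemma z_reg u : z * u = 0 -> u = 0.
Proof.
move=> u0; rewrite -(quozK C u) u0; exact: (iter_additive0 1 (quozD C)).
Qed.

(** The two coefficients form a regular sequence, so that only the Koszul syzygy remains. *)
Lemma syzygy_yz2 u v :
  u * (y * z ^+ 2) + v * (x * z ^+ 3 - y ^+ 4) = 0 ->
  exists w, u = w * (x * z ^+ 3 - y ^+ 4) /\ v = - w * (y * z ^+ 2).
Proof.
move=> uv.
(* From [z ^+ 3 * (x * v) = y * (v * y ^+ 3 - u * z ^+ 2)]: dividing by [z ^+ 3] and by [x] keeps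
   the factor [y]. *)
have [v1 v1E] : exists v1, v = y * v1.
  exists (quox (iter 3 quoz (v * y ^+ 3 - u * z ^+ 2))).
  have := iter_linear 3 1 (v * y ^+ 3 - u * z ^+ 2) (quozy C).
  rewrite expr1 -quoxy => <-.
  have -> : y * (v * y ^+ 3 - u * z ^+ 2) = z ^+ 3 * (x * v).
    by apply/eqP; rewrite -subr_eq0 -oppr_eq0 -uv; apply/eqP; ring.
  by rewrite iter_retraction ?quoxK //; apply: quozK.
have uv1 : z ^+ 2 * (u + v1 * x * z) = y ^+ 4 * v1.
  apply/eqP; rewrite -subr_eq0; apply/eqP/y_reg; rewrite -uv v1E; ring.
(* Likewise, dividing the last equation by [y ^+ 4] keeps the factor [z ^+ 2]. *)
have [w v1w] : exists w, v1 = z ^+ 2 * w.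
  exists (iter 4 quoy (u + v1 * x * z)).
  rewrite -(iter_linear _ _ _ (quoyz C)) uv1 iter_retraction //; exact: quoyK.
exists (- w); split; last by rewrite v1E v1w; ring.
apply/eqP; rewrite -subr_eq0; apply/eqP/z_reg/z_reg.
have /eqP := uv1; rewrite -subr_eq0 v1w => /eqP <-; ring.
Qed.

Lemma cst_xyz : [/\ cst x = 0, cst y = 0 & cst z = 0].
Proof.
split; apply/(nonunit_cst C)/(nonunit_xyz C).
- by exists 1, 0, 0; ring.
- by exists 0, 1, 0; ring.
- by exists 0, 0, 1; ring.
Qed.

(** For [q] in [m], the class of [q] in [m / m^2] in the basis [x, y, z]. *)
Definition linear_part (q : Q) : 'rV[k]_3 :=
  \row_j [:: cst (quox q); cst (quoy q); cst (quoz q)]`_j.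

Lemma linear_partD u v : linear_part (u + v) = linear_part u + linear_part v.
Proof.
apply/rowP => -[[|[|[|//]]] lt_j]; rewrite !mxE /=.
- by rewrite quoxD rmorphD.
- by rewrite quoyD rmorphD.
- by rewrite quozD rmorphD.
Qed.

Lemma linear_partM u v :
  cst v = 0 -> linear_part (u * v) = cst u *: linear_part v.
Proof.
move=> /(nonunit_cst C)/(nonunit_xyz C)[a [b [c ->]]].
have [cx cy cz] := cst_xyz.
have -> : u * (x * a + y * b + z * c) = x * (u * a) + y * (u * b) + z * (u * c).
  by ring.
apply/rowP => -[[|[|[|//]]] lt_j]; rewrite !mxE /=.
- rewrite !quoxD !quoxK !quoxy !quoxz !rmorphD !rmorphM.
  by rewrite ?cx ?cy ?cz; ring.
- rewrite !quoyD !quoyK !quoyx !quoyz !rmorphD !rmorphM.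
  by rewrite ?cx ?cy ?cz; ring.
- rewrite !quozD !quozK !quozx !quozy !rmorphD !rmorphM.
  by rewrite ?cx ?cy ?cz; ring.
Qed.

Lemma linear_part_sum b (F : 'I_b -> Q) :
  linear_part (\sum_i F i) = \sum_i linear_part (F i).
Proof.
elim/big_rec2: _ => [|i u v _ <-]; last exact: linear_partD.
have := linear_partD 0 0; rewrite addr0 => /eqP.
by rewrite -subr_eq subrr => /eqP.
Qed.

Lemma linear_part_xyz (j : 'I_3) : linear_part [:: x; y; z]`_j = delta_mx 0 j.
Proof.
have [cx cy cz] := cst_xyz.
apply/rowP => i; rewrite !mxE /= -[[:: x; y; z]`_j]mulr1.
case: j i => -[|[|[|//]]] lt_j -[[|[|[|//]]] lt_i] /=;
  rewrite ?(quoxK, quoyK, quozK, quoxy, quoxz, quoyx, quoyz, quozx, quozy);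
  by rewrite ?rmorphM ?cx ?cy ?cz ?mul0r // rmorph1.
Qed.

Variable I : idealr Q.
Hypothesis linear_part_ideal : forall q, q \in I -> linear_part q = 0.
Local Notation R := {ideal_quot I}.

(** Generators of the maximal ideal lift to elements of [m] whose linear parts span [k^3], as
    elements of the ideal have none. Comparing ranks gives at least three generators. *)
Lemma quot_edim3 : is_edim R 3.
Proof.
split.
  exists [:: \pi_R x; \pi_R y; \pi_R z] => //.
  exact: (quot_generates_max (nonunit_xyz C)).
move=> s gen_s.
have [t tE] := fin_all_exists (fun i : 'I_(size s) => pi_surj s`_i).
have nt i : cst (t i) = 0.
  apply/(nonunit_cst C); apply/(nonunit_pi (nonunit_xyz C) I).
  rewrite -tE; apply/gen_s.
  exists (fun j : nat => (j == i)%:R).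
  rewrite (bigD1 i) //= eqxx mul1r big1 ?addr0 //.
  by move=> j /negPf; rewrite -val_eqE /= => ->; rewrite mul0r.
have gen j : exists c : 'I_(size s) -> Q,
    linear_part [:: x; y; z]`_j = \sum_i cst (c i) *: linear_part (t i).
  have /gen_s[c cE] : nonunit (\pi_R [:: x; y; z]`_j).
    apply/(nonunit_pi (nonunit_xyz C) I)/(nonunit_xyz C).
    case: j => [|[|[|j]]] /=; rewrite ?nth_nil.
    - by exists 1, 0, 0; ring.
    - by exists 0, 1, 0; ring.
    - by exists 0, 0, 1; ring.
    - by exists 0, 0, 0; ring.
  have [c' c'E] := fin_all_exists (fun i : 'I_(size s) => pi_surj (c i)).
  exists c'; apply/eqP; rewrite -subr_eq0.
  rewrite (eq_bigr (fun i => linear_part (c' i * t i))); last first.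
    by move=> i _; rewrite linear_partM.
  have -> : \sum_i linear_part (c' i * t i) = linear_part (\sum_i c' i * t i).
    by rewrite linear_part_sum.
  have linN v : linear_part (- v) = - linear_part v.
    apply/eqP; rewrite -addr_eq0 -linear_partD addNr; apply/eqP.
    by have := linear_part_sum (fun _ : 'I_0 => 0); rewrite !big_ord0.
  rewrite -linN -linear_partD; apply/eqP/linear_part_ideal/pi_eq0.
  rewrite rmorphB rmorph_sum /= cE; apply/eqP; rewrite subr_eq0; apply/eqP.
  by apply: eq_bigr => i _; rewrite rmorphM /= -c'E -tE.
have [c cE] := fin_all_exists (fun j : 'I_3 => gen j).
pose A : 'M[k]_(3, size s) := \matrix_(j, i) cst (c j i).
pose B : 'M[k]_(size s, 3) := \matrix_i linear_part (t i).
have AB : A *m B = 1%:M.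
  apply/row_matrixP => j; rewrite row_mul row1 -linear_part_xyz cE.
  apply/rowP => i; rewrite !mxE summxE; apply: eq_bigr => h _.
  by rewrite !mxE.
have := leq_trans (mxrankM_maxl A B) (rank_leq_col A).
by rewrite AB mxrank1.
Qed.

End Coordinates.

(** * Computation with integer polynomials *)

(* A list of coefficients and exponents, so that polynomial identities can be
   decided by computation. *)
Definition poly3 := seq (int * (nat * nat * nat)).

Declare Scope poly3_scope.
Delimit Scope poly3_scope with P3.
Bind Scope poly3_scope with poly3.

Definition mono3 (i j k : nat) : poly3 := [:: (1, (i, j, k))].
Definition add3 (p q : poly3) : poly3 := p ++ q.
Definition opp3 (p : poly3) : poly3 := [seq (- t.1, t.2) | t <- p].
Definition mul3 (p q : poly3) : poly3 :=
  [seq (t.1 * u.1, (t.2.1.1 + u.2.1.1, t.2.1.2 + u.2.1.2, t.2.2 + u.2.2)%N)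
  | t <- p, u <- q].
Definition exp3 (p : poly3) (e : nat) : poly3 := iter e (mul3 p) (mono3 0 0 0).

Arguments mono3 : simpl never.
Arguments add3 : simpl never.
Arguments opp3 : simpl never.
Arguments mul3 : simpl never.
Arguments exp3 : simpl never.

Definition insert3 (t : int * (nat * nat * nat)) : poly3 -> poly3 :=
  fix insert p := if p is u :: p' then
    if t.2 == u.2 then (t.1 + u.1, u.2) :: p' else u :: insert p' else [:: t].
Definition collect3 (p : poly3) : poly3 := foldr insert3 [::] p.

Definition is0_3 (p : poly3) : bool := all (fun t => t.1 == 0) (collect3 p).
Definition no_const3 (p : poly3) : bool :=
  all (fun t => (t.1 == 0) || (t.2 != (0, 0, 0)%N)) (collect3 p).

Local Notation "0" := (@nil (int * (nat * nat * nat))) : poly3_scope.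
Local Notation "1" := (mono3 0 0 0) : poly3_scope.
Local Notation "p + q" := (add3 p q) : poly3_scope.
Local Notation "- p" := (opp3 p) : poly3_scope.
Local Notation "p - q" := (add3 p (opp3 q)) : poly3_scope.
Local Notation "p * q" := (mul3 p q) : poly3_scope.
Local Notation "p ^+ e" := (exp3 p e) : poly3_scope.
Local Notation X := (mono3 1 0 0).
Local Notation Y := (mono3 0 1 0).
Local Notation Z := (mono3 0 0 1).

Section Evaluation.
Variables (R : comNzRingType) (x y z : R).
Implicit Types p q : poly3.

Definition eval3 p : R :=
  \sum_(t <- p) t.1%:~R * (x ^+ t.2.1.1 * y ^+ t.2.1.2 * z ^+ t.2.2).

Lemma eval3_0 : eval3 0%P3 = 0.
Proof. exact: big_nil. Qed.

Lemma eval3_mono i j k : eval3 (mono3 i j k) = x ^+ i * y ^+ j * z ^+ k.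
Proof. by rewrite /eval3 big_seq1 mul1r. Qed.

Lemma eval3D p q : eval3 (p + q)%P3 = eval3 p + eval3 q.
Proof. exact: big_cat. Qed.

Lemma eval3N p : eval3 (- p)%P3 = - eval3 p.
Proof.
rewrite /eval3 big_map -sumrN; apply: eq_bigr => t _.
by rewrite /= rmorphN mulNr.
Qed.

Lemma eval3M p q : eval3 (p * q)%P3 = eval3 p * eval3 q.
Proof.
rewrite /eval3 big_distrlr /= big_allpairs_dep; apply: eq_bigr => t _.
by apply: eq_bigr => u _; rewrite /= rmorphM !exprD; ring.
Qed.

Lemma eval3X p e : eval3 (p ^+ e)%P3 = eval3 p ^+ e.
Proof.
elim: e => [|e IHe]; last by rewrite exprS -IHe -eval3M.
by rewrite eval3_mono !expr0 !mul1r.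
Qed.

Lemma eval3_1 : eval3 1%P3 = 1.
Proof. by rewrite eval3_mono !expr0 !mul1r. Qed.

Definition eval3E := (eval3D, eval3N, eval3M, eval3X, eval3_mono, eval3_0).

Lemma eval3_cons t p : eval3 (t :: p) = eval3 [:: t] + eval3 p.
Proof. by rewrite -eval3D. Qed.

Lemma eval3_collect p : eval3 (collect3 p) = eval3 p.
Proof.
elim: p => // t p IHp; rewrite eval3_cons -IHp /= {IHp}.
elim: (collect3 p) => [|u q IHq] /=; first by rewrite eval3_0 addr0.
case: eqP => [tu|_]; last first.
  by rewrite eval3_cons IHq (eval3_cons u q) addrCA.
rewrite eval3_cons (eval3_cons u q) addrA; congr (_ + _).
by rewrite /eval3 !big_seq1 /= tu rmorphD mulrDl.
Qed.

(** [collect3] merges terms with equal exponents, so an identity over the integers leaves only zero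
    coefficients; it then holds in any commutative ring. *)
Lemma eval3_eq p q : is0_3 (p - q)%P3 -> eval3 p = eval3 q.
Proof.
move=> /allP pq0; apply/eqP; rewrite -subr_eq0 -eval3N -eval3D.
rewrite -eval3_collect /eval3 big_seq big1 // => t /pq0/eqP ->.
by rewrite mul0r.
Qed.

Lemma eval3_nonunit p :
  is_ideal (@nonunit R) -> nonunit x -> nonunit y -> nonunit z ->
  no_const3 p -> nonunit (eval3 p).
Proof.
move=> [n0 nD nM] nx ny nz /allP p0; rewrite -eval3_collect /eval3 big_seq.
elim/big_ind: _ => // t /p0/orP[/eqP ->|]; first by rewrite mul0r.
have nX (u : R) e : (0 < e)%N -> nonunit u -> nonunit (u ^+ e).
  by case: e => // e _ nu; rewrite exprSr; apply: nM.
case: (t.2) => -[[|i] [|j]] [|k] // _; apply: (nM).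
- by apply: (nM); apply: nX.
- by rewrite mulrC; do 2 apply: (nM); apply: nX.
- by apply: (nM); apply: nX.
- by rewrite -mulrA mulrC; apply: (nM); apply: nX.
- by apply: (nM); apply: nX.
- by rewrite mulrC; apply: (nM); apply: (nM); apply: nX.
- by apply: (nM); apply: nX.
Qed.

(** Matrices as functions on [nat], so that [vm_compute] can evaluate products; the sizes are
    supplied by [evalmx] and by the checks. *)
Definition mxfun := nat -> nat -> poly3.
Implicit Types A B : mxfun.

Definition evalmx b c A : 'M[R]_(b, c) := \matrix_(i, j) eval3 (A i j).

Definition mulf b A B : mxfun :=
  fun i j => foldr add3 0%P3 [seq (A i t * B t j)%P3 | t <- iota 0 b].
Definition subf A B : mxfun := fun i j => (A i j - B i j)%P3.
Definition scalarf (p : poly3) : mxfun := fun i j => if i == j then p else 0%P3.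

Definition allf b c (P : nat -> nat -> bool) : bool :=
  all (fun i => all (P i) (iota 0 c)) (iota 0 b).
Definition eqf b c A B : bool := allf b c (fun i j => is0_3 (subf A B i j)).

Lemma allfP b c P : allf b c P -> forall (i : 'I_b) (j : 'I_c), P i j.
Proof.
have in_iota d (e : 'I_d) : (e : nat) \in iota 0 d by rewrite mem_iota /=.
by move=> /allP ok i j; have /allP := ok i (in_iota b i); apply.
Qed.

Lemma evalmx_mul b c d A B :
  evalmx b d (mulf c A B) = evalmx b c A *m evalmx c d B.
Proof.
apply/matrixP => i j; rewrite !mxE /mulf.
rewrite (eq_bigr (fun t : 'I_c => eval3 (A i t * B t j)%P3)); last first.
  by move=> t _; rewrite !mxE eval3M.
rewrite -(big_mkord xpredT (fun t => eval3 (A i t * B t j)%P3)).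
rewrite /index_iota subn0.
elim: (iota 0 c) => [|t s IHs]; first by rewrite big_nil eval3_0.
by rewrite big_cons -IHs -eval3D.
Qed.

Lemma evalmx_sub b c A B : evalmx b c (subf A B) = evalmx b c A - evalmx b c B.
Proof. by apply/matrixP => i j; rewrite !mxE eval3D eval3N. Qed.

Lemma evalmx_scalar b p : evalmx b b (scalarf p) = (eval3 p)%:M.
Proof.
apply/matrixP => i j; rewrite !mxE /scalarf -val_eqE /=.
by case: eqP; rewrite ?mulr1n ?mulr0n ?eval3_0.
Qed.

Lemma evalmx_eq b c A B : eqf b c A B -> evalmx b c A = evalmx b c B.
Proof.
by move=> /allfP ok; apply/matrixP => i j; rewrite !mxE; apply/eval3_eq/ok.
Qed.

End Evaluation.

(** * The resolutions *)

Definition entry (i j s : nat) (p : poly3) := (i, j, s, p).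

(* The rows of [dg_d2] and [dg_d3] are the images of the basis vectors, and
   [entry i j s p] says that the product of the i-th and the j-th basis vectors
   has the coordinate [p] on the s-th one; [dg_mul11] only lists i < j. *)
Record dg_data := DGData {
  dg_d1 : seq poly3;
  dg_d2 : seq (seq poly3);
  dg_d3 : seq (seq poly3);
  dg_mul11 : seq (nat * nat * nat * poly3);
  dg_mul12 : seq (nat * nat * nat * poly3) }.

(** The entries of [dg_mul12] equal to 1 are the only ones with a constant term, and all hit the
    0-th basis vector of [F_3]. There are two here and one more in each of the following lists,
    which is the parameter of class G. *)
Definition products1 : dg_data := DGData
  [:: X * Y ^+ 2; X * Y * Z; Y * Z ^+ 2; X ^+ 4 - Y ^+ 3 * Z;
      X * Z ^+ 3 - Y ^+ 4]%P3
  [::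
    [:: Z; - Y; 0; 0; 0];
    [:: 0; Z; - X; 0; 0];
    [:: 0; X ^+ 3; - Y ^+ 3; - (Y * Z); 0];
    [:: Y ^+ 3; 0; - (X ^+ 2 * Z); 0; X * Y];
    [:: X ^+ 3; 0; - (X * Z ^+ 2); - Y ^+ 2; Y * Z];
    [:: X ^+ 2 * Y ^+ 2; 0; - (Y ^+ 2 * Z ^+ 2); - Z ^+ 3; X ^+ 3]]%P3
  [::
    [:: X ^+ 4 - Y ^+ 3 * Z; - Y ^+ 4; X * Y; Z ^+ 2; - (X * Z); 0];
    [:: 0; X ^+ 3 * Z; - Z ^+ 2; - X ^+ 2; 0; Y]]%P3
  [:: entry 0 1 0 (- (X * Y)); entry 0 2 0 (- (Y * Z)); entry 0 2 1 (- Y ^+ 2);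
      entry 0 3 3 Z; entry 0 3 4 (- X); entry 0 4 0 (- (X * Z ^+ 2));
      entry 0 4 1 (- (X * Y * Z)); entry 0 4 3 Y; entry 1 2 1 (- (Y * Z));
      entry 1 3 1 (Y ^+ 3); entry 1 3 2 (- X); entry 1 4 0 (- Y ^+ 3);
      entry 1 4 1 (- (X * Z ^+ 2)); entry 1 4 3 Z; entry 2 3 1 (X ^+ 3);
      entry 2 3 2 (- Z); entry 2 4 0 (- X ^+ 3); entry 2 4 2 (- Y);
      entry 2 4 4 Z; entry 3 4 4 (- Y ^+ 2); entry 3 4 5 X]
  [:: entry 0 2 0 Y; entry 0 5 0 (Z ^+ 2); entry 0 5 1 (X * Y);
      entry 1 4 0 (- Y); entry 1 5 1 (X * Z); entry 2 3 0 Y;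
      entry 2 5 0 (X ^+ 2); entry 2 5 1 (Z ^+ 2); entry 3 0 0 1;
      entry 3 3 1 (- X ^+ 2); entry 3 4 1 (- (X * Z));
      entry 3 5 1 (- (Y ^+ 2 * Z)); entry 4 1 0 1; entry 4 2 1 (- (X * Z));
      entry 4 3 0 (X * Z); entry 4 4 1 (- (X * Y)); entry 4 5 1 (- Y ^+ 3)].

Definition products2 : dg_data := DGData
  [:: X * Y ^+ 2; X * Y * Z; Y * Z ^+ 2; X ^+ 4 - Y ^+ 3 * Z;
      X * Z ^+ 3 - Y ^+ 4; X ^+ 3 * Y - Z ^+ 4]%P3
  [::
    [:: Z; - Y; 0; 0; 0; 0];
    [:: 0; Z; - X; 0; 0; 0];
    [:: 0; 0; 0; Y; - Z; - X];
    [:: X ^+ 2; 0; - Z ^+ 2; 0; 0; - Y];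
    [:: Y ^+ 3; 0; - (X ^+ 2 * Z); 0; X * Y; 0];
    [:: 0; X ^+ 3; - Y ^+ 3; 0; - Z ^+ 2; - (X * Z)];
    [:: 0; 0; 0; Z ^+ 3; - X ^+ 3; - Y ^+ 3]]%P3
  [::
    [:: X ^+ 4 - Y ^+ 3 * Z; - Y ^+ 4; 0; - (X ^+ 2 * Z); Z ^+ 2; X * Y; 0];
    [:: 0; X ^+ 3 * Z; Z ^+ 3; Y ^+ 3; - X ^+ 2; - Z ^+ 2; - Y]]%P3
  [:: entry 0 1 0 (- (X * Y)); entry 0 2 0 (- (Y * Z)); entry 0 2 1 (- Y ^+ 2);
      entry 0 3 2 (X * Y); entry 0 3 3 (- X ^+ 2); entry 0 3 4 Z;
      entry 0 4 0 (- (X * Z ^+ 2)); entry 0 4 1 (- (X * Y * Z)); entry 0 4 4 Y;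
      entry 0 5 0 (Z ^+ 3); entry 0 5 1 (Y * Z ^+ 2); entry 0 5 3 (- (X * Y));
      entry 1 2 1 (- (Y * Z)); entry 1 3 1 (Y ^+ 3); entry 1 3 2 (X * Z);
      entry 1 3 5 (- X); entry 1 4 0 (- Y ^+ 3); entry 1 4 1 (- (X * Z ^+ 2));
      entry 1 4 4 Z; entry 1 5 0 (X ^+ 3); entry 1 5 1 (Z ^+ 3);
      entry 1 5 3 (- (X * Z)); entry 2 3 1 (X ^+ 3); entry 2 3 2 (Z ^+ 2);
      entry 2 3 5 (- Z); entry 2 4 0 (- X ^+ 3); entry 2 4 3 (X * Z);
      entry 2 4 5 (- Y); entry 2 5 0 (X ^+ 2 * Z); entry 2 5 1 (X ^+ 2 * Y);
      entry 2 5 3 (- Z ^+ 2); entry 3 4 2 (Y ^+ 3); entry 3 4 6 (- X);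
      entry 3 5 2 (- X ^+ 3); entry 3 5 6 Z; entry 4 5 2 (- Z ^+ 3);
      entry 4 5 6 Y]
  [:: entry 0 5 0 Y; entry 0 6 0 (- Z ^+ 2); entry 0 6 1 (- (X * Y));
      entry 1 2 0 1; entry 1 5 0 Z; entry 1 6 1 (- (X * Z)); entry 2 4 0 Y;
      entry 2 6 0 (- X ^+ 2); entry 2 6 1 (- Z ^+ 2); entry 3 0 0 1;
      entry 3 3 1 (- Z); entry 3 4 1 (- X ^+ 2); entry 4 1 0 1;
      entry 4 3 1 (- Y); entry 4 4 0 (X * Z); entry 4 5 1 (- (X * Z));
      entry 5 4 0 (- Z ^+ 2); entry 5 4 1 (- (X * Y)); entry 5 5 0 (X ^+ 2);
      entry 5 5 1 (Z ^+ 2)].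

Definition products3 : dg_data := DGData
  [:: X * Y ^+ 2; X * Y * Z; Y * Z ^+ 2; X ^+ 4 - Y ^+ 3 * Z;
      X * Z ^+ 3 - Y ^+ 4; X ^+ 3 * Y - Z ^+ 4; X ^+ 2 * Z ^+ 2]%P3
  [::
    [:: Z; - Y; 0; 0; 0; 0; 0];
    [:: 0; Z; - X; 0; 0; 0; 0];
    [:: 0; 0; 0; Y; - Z; - X; 0];
    [:: Y ^+ 2; 0; 0; 0; X; 0; - Z];
    [:: 0; X * Z; 0; 0; 0; 0; - Y];
    [:: X ^+ 2; 0; - Z ^+ 2; 0; 0; - Y; 0];
    [:: 0; 0; Y ^+ 2 * Z; Z ^+ 2; 0; 0; - X ^+ 2];
    [:: 0; X ^+ 3; - Y ^+ 3; 0; - Z ^+ 2; - (X * Z); 0]]%P3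
  [::
    [:: X ^+ 4 - Y ^+ 3 * Z; X * Z ^+ 3 - Y ^+ 4; 0; Y * Z ^+ 2; - Z ^+ 3;
        - (X ^+ 2 * Z); 0; X * Y];
    [:: 0; 0; Z ^+ 2; 0; X ^+ 2; 0; - Y; - Z]]%P3
  [:: entry 0 1 0 (- (X * Y)); entry 0 2 0 (- (Y * Z)); entry 0 2 1 (- Y ^+ 2);
      entry 0 3 1 (X * Z ^+ 2); entry 0 3 2 (X * Y); entry 0 3 3 (Y * Z);
      entry 0 3 4 (- Z ^+ 2); entry 0 3 5 (- X ^+ 2);
      entry 0 4 0 (- (X * Z ^+ 2)); entry 0 4 3 (Y ^+ 2);
      entry 0 4 4 (- (Y * Z)); entry 0 5 0 (Z ^+ 3); entry 0 5 1 (Y * Z ^+ 2);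
      entry 0 5 5 (- (X * Y)); entry 0 6 0 (- (X ^+ 2 * Z));
      entry 0 6 4 (- (X * Y)); entry 1 2 1 (- (Y * Z)); entry 1 3 1 (Y ^+ 3);
      entry 1 3 2 (X * Z); entry 1 3 7 (- X); entry 1 4 0 (- Y ^+ 3);
      entry 1 4 3 (Y * Z); entry 1 4 4 (- Z ^+ 2); entry 1 5 0 (X ^+ 3);
      entry 1 5 1 (Z ^+ 3); entry 1 5 5 (- (X * Z)); entry 1 6 4 (- (X * Z));
      entry 2 3 1 (X ^+ 3); entry 2 3 4 (- X ^+ 2); entry 2 3 6 Y;
      entry 2 4 0 (- X ^+ 3); entry 2 4 5 (X * Z); entry 2 4 7 (- Y);
      entry 2 5 0 (X ^+ 2 * Z); entry 2 5 1 (X ^+ 2 * Y);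
      entry 2 5 5 (- Z ^+ 2); entry 2 6 1 (X * Z ^+ 2); entry 2 6 4 (- Z ^+ 2);
      entry 3 4 2 (Y ^+ 3); entry 3 4 3 (X ^+ 3); entry 3 4 5 (- (X * Y ^+ 2));
      entry 3 4 6 (- (X * Z)); entry 3 5 2 (- X ^+ 3);
      entry 3 5 3 (- (X ^+ 2 * Z)); entry 3 5 5 (Y ^+ 2 * Z);
      entry 3 5 6 (Z ^+ 2); entry 3 6 1 (- (X * Y ^+ 2 * Z));
      entry 3 6 4 (Y ^+ 2 * Z); entry 3 6 6 (- X ^+ 2);
      entry 4 5 3 (- (X ^+ 2 * Y)); entry 4 5 4 (X ^+ 2 * Z);
      entry 4 5 5 (Y ^+ 3); entry 4 5 7 (- Z ^+ 2);
      entry 4 6 0 (X * Y ^+ 2 * Z); entry 4 6 3 (- (X * Z ^+ 2));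
      entry 4 6 4 (Y ^+ 3); entry 5 6 0 (- (Y ^+ 2 * Z ^+ 2));
      entry 5 6 1 (- (Y ^+ 3 * Z)); entry 5 6 3 (Z ^+ 3);
      entry 5 6 4 (- X ^+ 3); entry 5 6 7 (X * Z)]
  [:: entry 0 6 0 (- Z); entry 0 6 1 (- (X * Y)); entry 0 7 0 Y; entry 1 2 0 1;
      entry 1 6 1 (- (X * Z)); entry 1 7 0 Z; entry 2 2 1 Y; entry 2 3 0 1;
      entry 3 0 0 1; entry 3 1 1 X; entry 3 4 1 (X ^+ 2); entry 3 7 1 (Y ^+ 3);
      entry 4 1 0 1; entry 4 2 1 (X * Z); entry 4 6 1 (Y ^+ 3);
      entry 5 2 1 (- Z ^+ 2); entry 5 4 0 Z; entry 5 6 1 (- X ^+ 3);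
      entry 5 7 0 (X ^+ 2); entry 6 2 1 (X ^+ 2); entry 6 5 0 (- Z)].

Definition products4 : dg_data := DGData
  [:: X * Y ^+ 2; X * Y * Z; Y * Z ^+ 2; X ^+ 4 - Y ^+ 3 * Z;
      X * Z ^+ 3 - Y ^+ 4; X ^+ 3 * Y - Z ^+ 4; X ^+ 2 * Z ^+ 2; X ^+ 3 * Z]%P3
  [::
    [:: Z; - Y; 0; 0; 0; 0; 0; 0];
    [:: 0; Z; - X; 0; 0; 0; 0; 0];
    [:: 0; 0; 0; Y; - Z; - X; 0; 0];
    [:: Y ^+ 2; 0; 0; 0; X; 0; - Z; 0];
    [:: 0; 0; - Y ^+ 2; - Z; 0; 0; 0; X];
    [:: 0; X * Z; 0; 0; 0; 0; - Y; 0];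
    [:: 0; X ^+ 2; 0; 0; 0; 0; 0; - Y];
    [:: 0; 0; 0; 0; 0; 0; X; - Z];
    [:: X ^+ 2; 0; - Z ^+ 2; 0; 0; - Y; 0; 0]]%P3
  [::
    [:: X ^+ 4 - Y ^+ 3 * Z; X * Z ^+ 3 - Y ^+ 4; X * Y * Z; Y * Z ^+ 2;
        X * Y ^+ 2; - Z ^+ 3; X ^+ 2 * Y; 0; - (X ^+ 2 * Z)];
    [:: 0; 0; 0; 0; 0; X; - Z; Y; 0]]%P3
  [:: entry 0 1 0 (- (X * Y)); entry 0 2 0 (- (Y * Z)); entry 0 2 1 (- Y ^+ 2);
      entry 0 3 1 (X * Z ^+ 2); entry 0 3 2 (X * Y); entry 0 3 3 (Y * Z);
      entry 0 3 5 (- Z ^+ 2); entry 0 3 8 (- X ^+ 2);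
      entry 0 4 0 (- (X * Z ^+ 2)); entry 0 4 3 (Y ^+ 2);
      entry 0 4 5 (- (Y * Z)); entry 0 5 0 (Z ^+ 3); entry 0 5 1 (Y * Z ^+ 2);
      entry 0 5 8 (- (X * Y)); entry 0 6 0 (- (X ^+ 2 * Z));
      entry 0 6 6 (- (Y * Z)); entry 0 6 7 (Y ^+ 2); entry 0 7 0 (- X ^+ 3);
      entry 0 7 6 (- (X * Y)); entry 1 2 1 (- (Y * Z)); entry 1 3 1 (Y ^+ 3);
      entry 1 3 4 (- (X * Y)); entry 1 3 6 (- X ^+ 2); entry 1 4 0 (- Y ^+ 3);
      entry 1 4 3 (Y * Z); entry 1 4 5 (- Z ^+ 2); entry 1 5 0 (X ^+ 3);
      entry 1 5 1 (Z ^+ 3); entry 1 5 8 (- (X * Z)); entry 1 6 6 (- Z ^+ 2);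
      entry 1 6 7 (Y * Z); entry 1 7 6 (- (X * Z)); entry 2 3 1 (X ^+ 3);
      entry 2 3 4 (- (Y * Z)); entry 2 3 6 (- (X * Z)); entry 2 4 0 (- X ^+ 3);
      entry 2 4 2 (- (Y * Z)); entry 2 4 4 (- Y ^+ 2); entry 2 4 6 (- (X * Y));
      entry 2 4 8 (X * Z); entry 2 5 0 (X ^+ 2 * Z); entry 2 5 1 (X ^+ 2 * Y);
      entry 2 5 8 (- Z ^+ 2); entry 2 6 1 (X * Z ^+ 2); entry 2 6 5 (- Z ^+ 2);
      entry 2 7 1 (X ^+ 2 * Z); entry 2 7 6 (- Z ^+ 2); entry 3 4 2 (Y ^+ 3);
      entry 3 4 3 (X ^+ 3); entry 3 4 4 (X * Z ^+ 2); entry 3 4 7 (X ^+ 2 * Z);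
      entry 3 4 8 (- (X * Y ^+ 2)); entry 3 5 2 (- X ^+ 3);
      entry 3 5 3 (- (X ^+ 2 * Z)); entry 3 5 4 (- Z ^+ 3);
      entry 3 5 7 (- (X * Z ^+ 2)); entry 3 5 8 (Y ^+ 2 * Z);
      entry 3 6 1 (- (X * Y ^+ 2 * Z)); entry 3 6 4 (X ^+ 2 * Z);
      entry 3 6 5 (Y ^+ 2 * Z); entry 3 6 7 (X ^+ 3);
      entry 3 7 1 (- (X ^+ 2 * Y ^+ 2)); entry 3 7 4 (X ^+ 3);
      entry 3 7 6 (Y ^+ 2 * Z); entry 4 5 2 (- Z ^+ 3);
      entry 4 5 3 (- (X ^+ 2 * Y)); entry 4 5 4 (- (Y * Z ^+ 2));
      entry 4 5 7 (- (X * Y * Z)); entry 4 5 8 (Y ^+ 3);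
      entry 4 6 0 (X * Y ^+ 2 * Z); entry 4 6 3 (- (X * Z ^+ 2));
      entry 4 6 5 (Y ^+ 3); entry 4 7 0 (X ^+ 2 * Y ^+ 2);
      entry 4 7 3 (- (X ^+ 2 * Z)); entry 4 7 6 (Y ^+ 3);
      entry 4 7 7 (- (X * Z ^+ 2)); entry 5 6 0 (- (Y ^+ 2 * Z ^+ 2));
      entry 5 6 1 (- (Y ^+ 3 * Z)); entry 5 6 2 (X * Z ^+ 2);
      entry 5 6 3 (Z ^+ 3); entry 5 6 4 (X * Y * Z); entry 5 6 7 (X ^+ 2 * Y);
      entry 5 7 0 (- (X * Y ^+ 2 * Z)); entry 5 7 1 (- (X * Y ^+ 3));
      entry 5 7 2 (X ^+ 2 * Z); entry 5 7 3 (X * Z ^+ 2);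
      entry 5 7 4 (X ^+ 2 * Y); entry 5 7 7 (Z ^+ 3);
      entry 6 7 7 (- (X ^+ 2 * Z))]
  [:: entry 0 3 1 (Y * Z); entry 0 4 0 1; entry 0 5 1 (Y ^+ 2); entry 1 2 0 1;
      entry 1 3 1 (Z ^+ 2); entry 1 5 1 (Y * Z); entry 2 3 0 1;
      entry 2 7 1 (Z ^+ 2); entry 3 0 0 1; entry 3 5 1 (X ^+ 3);
      entry 3 7 1 (- (Y ^+ 2 * Z)); entry 3 8 1 (- (X * Z ^+ 2));
      entry 4 1 0 1; entry 4 6 1 (- (X * Z ^+ 2)); entry 4 7 1 (- Y ^+ 3);
      entry 4 8 1 (- (X * Y * Z)); entry 5 5 0 Z; entry 5 5 1 (X ^+ 2 * Y);
      entry 5 6 0 X; entry 5 6 1 (Z ^+ 3); entry 6 1 1 (Z ^+ 2);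
      entry 6 3 1 (Y ^+ 3); entry 6 5 1 (X * Z ^+ 2); entry 6 8 0 (- Z);
      entry 7 5 1 (X ^+ 2 * Z); entry 7 8 0 (- X); entry 7 8 1 (- Z ^+ 3)].

(* The position in [dg_d1] of the generator whose product with the i-th basis
   vector of [F_2] is the 0-th basis vector of [F_3], for i < r. *)
Definition pairing_order : seq nat := [:: 3; 4; 1; 2; 0; 5; 6; 7].

(** * Computable checks on the data and their consequences *)

Section Check.
Variables (D : dg_data) (l r : nat).
Local Notation N := l.+1.
Local Notation m := (2 + l)%N.

(** An unlisted product gives the empty list, which is the zero polynomial. *)
Definition coef3 (t : seq (nat * nat * nat * poly3)) (i j s : nat) : poly3 :=
  flatten [seq e.2 | e <- t & e.1 == (i, j, s)].

Definition fun_d1 : mxfun := fun i _ => nth 0%P3 (dg_d1 D) i.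
Definition fun_d2 : mxfun := fun i j => nth 0%P3 (nth [::] (dg_d2 D) i) j.
Definition fun_d3 : mxfun := fun i j => nth 0%P3 (nth [::] (dg_d3 D) i) j.
Definition fun_left11 (i : nat) : mxfun := fun j s =>
  if (i < j)%N then coef3 (dg_mul11 D) i j s
  else if (j < i)%N then (- coef3 (dg_mul11 D) j i s)%P3 else 0%P3.
Definition fun_left12 (i : nat) : mxfun := coef3 (dg_mul12 D) i.
Definition fun_0 : mxfun := fun _ _ => 0%P3.
(** [x^5 = y z (x y^2) + x (x^4 - y^3 z)], [y^5 = z^2 (x y z) - y (x z^3 - y^4)] and, from g_2 on,
    [z^5 = x^2 (x y z) - z (x^3 y - z^4)]. Padding by zeros lets the same lists serve for the longer
    sequences of generators. *)
Definition x5_cofactors : seq poly3 := [:: Y * Z; 0; 0; X]%P3.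
Definition y5_cofactors : seq poly3 := [:: 0; Z ^+ 2; 0; 0; - Y]%P3.
Definition z5_cofactors : seq poly3 := [:: 0; X ^+ 2; 0; 0; 0; - Z]%P3.
Definition rowf (s : seq poly3) : mxfun := fun _ i => nth 0%P3 s i.

Definition check_complex : bool :=
  eqf m 1 (mulf N fun_d2 fun_d1) fun_0 && eqf 2 N (mulf m fun_d3 fun_d2) fun_0.

Definition check_leibniz (i : nat) : bool :=
  [&& eqf N N (mulf m (fun_left11 i) fun_d2)
        (subf (scalarf (fun_d1 i 0%N))
           (fun j s => if s == i then fun_d1 j 0%N else 0%P3)),
      eqf m m (mulf 2 (fun_left12 i) fun_d3)
        (subf (scalarf (fun_d1 i 0%N)) (mulf N fun_d2 (fun_left11 i)))
    & eqf 2 2 (mulf m fun_d3 (fun_left12 i)) (scalarf (fun_d1 i 0%N))].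

(** The first condition places the ideal in [m^2], which fixes the embedding dimension; the last one
    says that [A_1] times [A_1] vanishes. *)
Definition check_minimal : bool :=
  [&& all (all (fun t => 1 < t.2.1.1 + t.2.1.2 + t.2.2)%N) (dg_d1 D),
      allf N 1 (fun i j => no_const3 (fun_d1 i j)),
      allf m N (fun i j => no_const3 (fun_d2 i j)),
      allf 2 m (fun i j => no_const3 (fun_d3 i j))
    & allf N N (fun i j =>
        all (fun s => no_const3 (fun_left11 i j s)) (iota 0 m))].

Definition check_pairing : bool :=
  let s := take N pairing_order in
  [&& uniq s, size s == N, all (fun i => (i < N)%N) s, (r <= N)%N, (r <= m)%N
    & allf N m (fun i j => all (fun t => no_const3 (fun_left12 (nth 0%N s i) j t
        - (if [&& i == j, i < r & t == 0]%N then 1 else 0))%P3) (iota 0 2))].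

Definition check_powers : bool :=
  eqf 1 1 (mulf N (rowf x5_cofactors) fun_d1) (fun _ _ => X ^+ 5)%P3 &&
  eqf 1 1 (mulf N (rowf y5_cofactors) fun_d1) (fun _ _ => Y ^+ 5)%P3.

Definition check_data : bool :=
  [&& check_complex, all check_leibniz (iota 0 N), check_minimal,
      check_pairing & check_powers].

End Check.

Section LinearPart.
Variables (k : fieldType) (Q : comNzRingType) (x y z : Q).
Variable C : coordinates k x y z.

Lemma nonunit_is_ideal : is_ideal (@nonunit Q).
Proof. exact: nonunit_ideal (nonunit_xyz C). Qed.

Lemma nonunit_coord : [/\ nonunit x, nonunit y & nonunit z].
Proof. by have [? ? ?] := cst_xyz C; split; apply/(nonunit_cst C). Qed.

Lemma eval3_nonunit_coord p : no_const3 p -> nonunit (eval3 x y z p).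
Proof.
have [nx ny nz] := nonunit_coord.
exact: eval3_nonunit nonunit_is_ideal nx ny nz.
Qed.

(** One variable is split off each monomial; by the degree bound the cofactor is still a nonunit,
    and a product of two nonunits has no linear part. *)
Lemma linear_part_eval3 p :
  all (fun t => 1 < t.2.1.1 + t.2.1.2 + t.2.2)%N p ->
  linear_part C (eval3 x y z p) = 0.
Proof.
have lin0 u v : nonunit u -> nonunit v -> linear_part C (u * v) = 0.
  by move=> /(nonunit_cst C) u0 /(nonunit_cst C) v0;
    rewrite linear_partM // u0 scale0r.
have [nx ny nz] := nonunit_coord.
elim: p => [_|t p IHp /= /andP[t1 /IHp p0]].
  have := linear_part_sum C (fun _ : 'I_0 => 0).
  by rewrite eval3_0 !big_ord0.
rewrite eval3_cons linear_partD p0 addr0 {p0 IHp}.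
case: t t1 => c [[[|i] j] e] /= t1; last first.
  rewrite (_ : eval3 _ _ _ _ = eval3 x y z [:: (c, (i, j, e))] * x).
    by apply: lin0 => //; apply: eval3_nonunit_coord; rewrite /no_const3 /=;
      case: i j e t1 => [|i] [|j] [|e] //= _; rewrite orbT.
  by rewrite /eval3 !big_seq1 /= exprS; ring.
case: j t1 => [|j] t1.
  case: e t1 => [|[|e]] // t1.
  rewrite (_ : eval3 _ _ _ _ = eval3 x y z [:: (c, (0, 0, e.+1)%N)] * z).
    by apply: lin0 => //; apply: eval3_nonunit_coord;
      rewrite /no_const3 /= orbT.
  by rewrite /eval3 !big_seq1 /= exprS; ring.
rewrite (_ : eval3 _ _ _ _ = eval3 x y z [:: (c, (0, j, e)%N)] * y).
  by apply: lin0 => //; apply: eval3_nonunit_coord; rewrite /no_const3 /=;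
    case: j e t1 => [|j] [|e] //= _; rewrite orbT.
by rewrite /eval3 !big_seq1 /= exprS; ring.
Qed.

End LinearPart.

Section Soundness.
Variables (k : fieldType) (Q : comNzRingType) (x y z : Q).
Variable C : coordinates k x y z.
Variables (I : idealr Q) (D : dg_data) (l r : nat).
Local Notation N := l.+1.
Local Notation m := (2 + l)%N.
Local Notation ev b c A := (evalmx x y z b c A).
Let d1 := ev N 1 (fun_d1 D).
Let d2 := ev m N (fun_d2 D).
Let d3 := ev 2 m (fun_d3 D).
Let L (i : 'I_N) := ev N m (fun_left11 D i).
Let M (i : 'I_N) := ev m 2 (fun_left12 D i).

Hypothesis checkD : check_data D l r.
Hypothesis memI : forall q, q \in I <-> exists a : 'rV_N, q = (a *m d1) 0 0.
Hypothesis ZK : forall a : 'rV_N,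
  a *m d1 = 0 -> exists f : 'rV_m, z ^+ 5 *: a = f *m d2.

Lemma evalmx0 b c : ev b c fun_0 = 0.
Proof. by apply/matrixP => i j; rewrite !mxE eval3_0. Qed.

Lemma data_d21 : d2 *m d1 = 0.
Proof.
have /and5P[/andP[ok _] _ _ _ _] := checkD.
by rewrite -evalmx_mul (evalmx_eq _ _ _ ok) evalmx0.
Qed.

Lemma data_d32 : d3 *m d2 = 0.
Proof.
have /and5P[/andP[_ ok] _ _ _ _] := checkD.
by rewrite -evalmx_mul (evalmx_eq _ _ _ ok) evalmx0.
Qed.

Lemma data_LN i j : row i (L j) = - row j (L i).
Proof.
apply/rowP => s; rewrite !mxE /fun_left11.
by case: (ltngtP i j) => _; rewrite ?eval3N ?opprK // eval3_0 oppr0.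
Qed.

Lemma data_L0 i : row i (L i) = 0.
Proof. by apply/rowP => s; rewrite !mxE /fun_left11 ltnn eval3_0. Qed.

Lemma data_leibniz (i : 'I_N) :
  [/\ L i *m d2 = (d1 i 0)%:M - d1 *m delta_mx 0 i,
      M i *m d3 = (d1 i 0)%:M - d2 *m L i
    & d3 *m M i = (d1 i 0)%:M].
Proof.
have /and5P[_ /allP ok _ _ _] := checkD.
have /and3P[ok1 ok2 ok3] : check_leibniz D l i.
  by apply: ok; rewrite mem_iota /=.
have d1E : d1 i 0 = eval3 x y z (fun_d1 D i 0) by rewrite mxE.
rewrite d1E -!evalmx_scalar -!evalmx_mul (evalmx_eq _ _ _ ok1).
rewrite (evalmx_eq _ _ _ ok2) (evalmx_eq _ _ _ ok3) !evalmx_sub; split=> //.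
congr (_ - _); apply/matrixP => j s; rewrite !mxE big_ord1 !mxE.
rewrite eqxx /= -(inj_eq val_inj) eq_sym /=.
by case: eqP; rewrite ?eval3_0 ?mulr1 ?mulr0 // eq_sym.
Qed.

Lemma row1_eval (s : seq poly3) p :
  eqf 1 1 (mulf N (rowf s) (fun_d1 D)) (fun _ _ => p) ->
  exists a : 'rV_N, (a *m d1) 0 0 = eval3 x y z p.
Proof.
move=> ok; exists (ev 1 N (rowf s)).
by rewrite -evalmx_mul (evalmx_eq _ _ _ ok) mxE.
Qed.

Lemma data_x5 : exists a : 'rV_N, (a *m d1) 0 0 = x ^+ 5.
Proof.
have /and5P[_ _ _ _ /andP[/row1_eval[a aE] _]] := checkD.
by exists a; rewrite aE !eval3E; ring.
Qed.

Lemma data_y5 : exists a : 'rV_N, (a *m d1) 0 0 = y ^+ 5.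
Proof.
have /and5P[_ _ _ _ /andP[_ /row1_eval[a aE]]] := checkD.
by exists a; rewrite aE !eval3E; ring.
Qed.

Lemma data_min1 i j : nonunit (d1 i j).
Proof.
have /and5P[_ _ /and5P[_ /allfP ok _ _ _] _ _] := checkD.
by rewrite mxE; apply: (eval3_nonunit_coord C).
Qed.

Lemma data_min2 i j : nonunit (d2 i j).
Proof.
have /and5P[_ _ /and5P[_ _ /allfP ok _ _] _ _] := checkD.
by rewrite mxE; apply: (eval3_nonunit_coord C).
Qed.

Lemma data_min3 i j : nonunit (d3 i j).
Proof.
have /and5P[_ _ /and5P[_ _ _ /allfP ok _] _ _] := checkD.
by rewrite mxE; apply: (eval3_nonunit_coord C).
Qed.

Lemma data_minL i j s : nonunit (L i j s).
Proof.
have /and5P[_ _ /and5P[_ _ _ _ /allfP ok] _ _] := checkD.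
rewrite mxE; apply: (eval3_nonunit_coord C).
by have /allP := ok i j; apply; rewrite mem_iota /=.
Qed.

Definition data_resolution : dg_resolution I :=
  @dg_of_products Q l 2 d1 d2 d3 L M data_d21 data_d32 data_L0 data_LN
    (fun i => let: And3 e _ _ := data_leibniz i in e)
    (fun i => let: And3 _ e _ := data_leibniz i in e)
    (fun i => let: And3 _ _ e := data_leibniz i in e)
    _ _ _ (regular3_exp C 5) data_x5 data_y5 ZK I memI
    data_min1 data_min2 data_min3.

Lemma linear_part_data q : q \in I -> linear_part C q = 0.
Proof.
have /and5P[_ _ /and5P[/allP ok _ _ _ _] _ _] := checkD.
move=> /memI[a ->]; rewrite mxE linear_part_sum big1 // => i _.
rewrite linear_partM; last exact/(nonunit_cst C)/data_min1.
rewrite mxE /fun_d1; case: (ltnP i (size (dg_d1 D))) => [lti|lei].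
  by rewrite linear_part_eval3 ?scaler0 //; apply/ok/mem_nth.
by rewrite nth_default // linear_part_eval3 ?scaler0.
Qed.

Lemma data_depth0 : is_depth {ideal_quot I} 0.
Proof.
exact: (quot_depth0 (nonunit_xyz C) (regular3_xyz C) (F := data_resolution)).
Qed.

Lemma data_embcodepth : embcodepth {ideal_quot I} 3.
Proof.
exists 3, 0; split=> //; last exact: data_depth0.
exact: (quot_edim3 linear_part_data).
Qed.

Lemma data_type : has_type {ideal_quot I} 2.
Proof.
exists 0%N; first exact: data_depth0.
exact: (quot_rank_ext0 (nonunit_xyz C) (regular3_xyz C) data_resolution).
Qed.

Lemma data_class_G : (1 < r)%N -> class_G I r.
Proof.
move=> r_gt1; split=> //; first exact: data_embcodepth.
have /and5P[_ _ _ /and5P[uniq_s /eqP size_s /allP lt_s rN rest] _] :=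
  checkD.
case/andP: rest => rm /allfP ok.
set s := take N pairing_order in uniq_s size_s lt_s ok.
have lt_sN (i : 'I_N) : (nth 0 s i < N)%N by apply/lt_s/mem_nth; rewrite size_s.
pose sg (i : 'I_N) := Ordinal (lt_sN i).
have inj_sg : injective sg.
  by move=> i j [] /eqP; rewrite nth_uniq ?size_s // => /eqP/val_inj.
have [n0 nD nM] := nonunit_is_ideal C.
have n00 : nonunit (0 : Q) := n0.
(* Only the basis of [A_1] is reordered; those of [A_2] and [A_3] are the standard ones. *)
exists data_resolution, (fun i => delta_mx 0 (sg i)).
exists (delta_mx 0), (delta_mx 0), ord0.
split=> // [|i j t|i j t].
- split; first exact: tensor_basis_delta.
    exact: (@tensor_basis_delta Q _ id).
  exact: (@tensor_basis_delta Q _ id).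
- by rewrite [mul11 _ _ _]prod11_delta mxE; apply: data_minL.
- rewrite [mul12 _ _ _]prod12_delta.
  have := ok i j => /allP/(_ t); rewrite mem_iota /= => /(_ (ltn_ord t)).
  move=> /(eval3_nonunit_coord C); rewrite eval3D eval3N !mxE /=.
  have -> : eval3 x y z (if [&& (i == j :> nat), (i < r)%N & (t == 0%N :> nat)]
        then 1%P3 else 0%P3) =
      ((if (i == j :> nat) && (i < r)%N then delta_mx 0 ord0 else 0)
        : 'rV[Q]_2) 0 t.
    case: (_ == _) (_ < r)%N => -[] /=; rewrite ?eval3_0 ?mxE //.
    by case: (t) => -[|[|//]] ?; [exact: eval3_1 | exact: eval3_0].
  by [].
Qed.

End Soundness.

(** * Annihilation of [H_1] by the fifth power of [z] *)

Section FifthPower.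
Variables (k : fieldType) (Q : comNzRingType) (x y z : Q).
Variable C : coordinates k x y z.
Local Notation ev b c A := (evalmx x y z b c A).

Lemma kill_z5 (D : dg_data) (l r : nat) :
  check_data D l r ->
  eqf 1 1 (mulf l.+1 (rowf z5_cofactors) (fun_d1 D)) (fun _ _ => Z ^+ 5)%P3 ->
  forall a : 'rV_l.+1, a *m ev l.+1 1 (fun_d1 D) = 0 ->
  exists f : 'rV_(2 + l), z ^+ 5 *: a = f *m ev (2 + l) l.+1 (fun_d2 D).
Proof.
move=> ok /(row1_eval x y z)[c cE] a a0.
have -> : z ^+ 5 = (c *m ev l.+1 1 (fun_d1 D)) 0 0 by rewrite cE !eval3E; ring.
pose L i := ev l.+1 (2 + l) (fun_left11 D i).
apply: (mem_ideal_kill1 (L := L)) a0 => i.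
by have [] := data_leibniz x y z ok i.
Qed.

(* For [g_1], which contains no power of [z], one has
   [z^5 = z5_homotopy d2 + z5_rest z5_proj] on [F_1], where [z5_proj] is the
   inclusion of the span of the basis vectors over [y z^2] and [x z^3 - y^4].
   These form a regular sequence, so that the syzygies in this span are
   multiples of the Koszul one, which is [z5_koszul d2]. *)
Definition z5_homotopy : seq (seq poly3) :=
  [:: [:: Z ^+ 4; Y * Z ^+ 3]; [:: 0; Z ^+ 4]; [::];
      [:: X ^+ 2 * Y ^+ 2 * Z; X ^+ 2 * Y ^+ 3; 0; 0; 0; - Z ^+ 2]]%P3.
Definition z5_rest : seq (seq poly3) :=
  [:: [:: X * Y * Z ^+ 3]; [:: X * Z ^+ 4]; [:: Z ^+ 5];
      [:: X ^+ 3 * Y ^+ 3 - Y ^+ 2 * Z ^+ 4; X ^+ 3 * Z ^+ 2];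
      [:: 0; Z ^+ 5]]%P3.
Definition z5_proj : seq (seq poly3) :=
  [:: [:: 0; 0; 1]; [:: 0; 0; 0; 0; 1]]%P3.
Definition z5_koszul : seq poly3 := [:: X ^+ 3; 0; Y; 0; - Z]%P3.
Definition z5_relation : seq poly3 :=
  [:: X * Z ^+ 3 - Y ^+ 4; - (Y * Z ^+ 2)]%P3.
Definition seqf (s : seq (seq poly3)) : mxfun :=
  fun i j => nth 0%P3 (nth [::] s i) j.

Lemma kill_z5_g1 (a : 'rV_5) : a *m ev 5 1 (fun_d1 products1) = 0 ->
  exists f : 'rV_6, z ^+ 5 *: a = f *m ev 6 5 (fun_d2 products1).
Proof.
set d1 := ev 5 1 _; set d2 := ev 6 5 _ => a0.
pose W := ev 5 6 (seqf z5_homotopy); pose B := ev 5 2 (seqf z5_rest).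
pose E := ev 2 5 (seqf z5_proj); pose K := ev 1 6 (rowf z5_koszul).
pose rel := ev 1 2 (rowf z5_relation).
have d21 : d2 *m d1 = 0 by apply: (@data_d21 _ x y z products1 4 2); vm_compute.
(* The rows of [B] write [z^5] times each generator through [y z^2] and [x z^3 - y^4]; for example
   [z^5 (x^4 - y^3 z) = (x^3 y^3 - y^2 z^4) (y z^2) + x^3 z^2 (x z^3 - y^4)]. *)
have z5E : (z ^+ 5)%:M - W *m d2 = B *m E.
  have -> : (z ^+ 5)%:M = ev 5 5 (scalarf (Z ^+ 5)%P3).
    by rewrite evalmx_scalar !eval3E; congr (_%:M); ring.
  by rewrite -!evalmx_mul -evalmx_sub; apply: evalmx_eq; vm_compute.
have KE : K *m d2 = rel *m E.
  by rewrite -!evalmx_mul; apply: evalmx_eq; vm_compute.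
have aE : z ^+ 5 *: a = a *m W *m d2 + a *m B *m E.
  by rewrite -[a *m B *m E]mulmxA -z5E mulmxBr mul_mx_scalar mulmxA addrC subrK.
move: (a *m B) aE => b aE.
have bE : b *m E *m d1 = 0.
  have := congr1 (mulmx^~ d1) aE.
  rewrite mulmxDl -scalemxAl a0 scaler0 -[_ *m d2 *m d1]mulmxA d21 mulmx0 add0r.
  by move/esym.
have b0 : b 0 0 * (y * z ^+ 2) + b 0 1 * (x * z ^+ 3 - y ^+ 4) = 0.
  have Ed1 : E *m d1 =
      ev 2 1 (seqf [:: [:: Y * Z ^+ 2]; [:: X * Z ^+ 3 - Y ^+ 4]]%P3).
    by rewrite -evalmx_mul; apply: evalmx_eq; vm_compute.
  have := congr1 (fun A : 'M_1 => A 0 0) bE.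
  rewrite -mulmxA Ed1 !mxE !big_ord_recl big_ord0 addr0 !mxE.
  rewrite [eval3 _ _ _ (seqf _ _ _)](_ : _ = y * z ^+ 2); last first.
    by rewrite /seqf /= !eval3E; ring.
  rewrite [eval3 _ _ _ (seqf _ _ _)](_ : _ = x * z ^+ 3 - y ^+ 4); last first.
    by rewrite /seqf /= !eval3E; ring.
  by rewrite (_ : lift ord0 ord0 = 1) //; apply: val_inj.
have [w [w0 w1]] := syzygy_yz2 C b0.
(* [b] is [w] times the Koszul relation, so that [b *m E] is the boundary of [w *: K]. *)
exists (a *m W + w *: K); rewrite aE mulmxDl -scalemxAl KE scalemxAl.
congr (_ + _ *m _); apply/rowP => -[[|[|//]] lt_j]; rewrite !mxE.
  rewrite (_ : Ordinal _ = 0) ?w0; last exact: val_inj.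
  by congr (w * _); rewrite /rowf /= !eval3E; ring.
rewrite (_ : Ordinal _ = 1) ?w1; last exact: val_inj.
by rewrite mulNr -mulrN; congr (w * _); rewrite /rowf /= !eval3E; ring.
Qed.

End FifthPower.

(** * The four ideals over a ring with coordinates *)

Section Assembly.
Variables (k : fieldType) (Q : comNzRingType) (x y z : Q).
Variable C : coordinates k x y z.

Definition products (n : nat) : dg_data :=
  match n with
  | 1 => products1 | 2 => products2 | 3 => products3 | _ => products4
  end.

Lemma idealgen_data (D : dg_data) (l : nat) q : size (dg_d1 D) = l.+1 ->
  idealgen [seq eval3 x y z p | p <- dg_d1 D] q <->
  exists a : 'rV_l.+1, q = (a *m evalmx x y z l.+1 1 (fun_d1 D)) 0 0.
Proof.
move=> sD; rewrite /idealgen size_map sD; split=> [[c ->]|[a ->]].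
  exists (\row_j c j); rewrite mxE; apply: eq_bigr => i _.
  by rewrite !mxE (nth_map 0%P3) ?sD.
exists (fun i => a 0 (inord i)); rewrite mxE; apply: eq_bigr => i _.
by rewrite inord_val !mxE (nth_map 0%P3) ?sD.
Qed.

Lemma ideal_data (I : idealr Q) (n : nat) : (0 < n <= 4)%N ->
  (forall q, q \in I <->
     idealgen [seq eval3 x y z p | p <- dg_d1 (products n)] q) ->
  [/\ local_ring {ideal_quot I}, embcodepth {ideal_quot I} 3,
      has_type {ideal_quot I} 2 & class_G I n.+1].
Proof.
(* The n-th ideal has [n + 4] listed generators, that is [l.+1]. *)
move=> hn memI; pose l := (n + 3)%N.
have [size_d1 ok z5] : [/\ size (dg_d1 (products n)) = l.+1,
    check_data (products n) l n.+1
  & (1 < n)%N -> eqf 1 1 (mulf l.+1 (rowf z5_cofactors) (fun_d1 (products n)))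
                   (fun _ _ => Z ^+ 5)%P3].
  by case: (n) hn @l => [|[|[|[|[|//]]]]] // _; split=> //; vm_compute.
have mem q : q \in I <->
    exists a : 'rV_l.+1,
      q = (a *m evalmx x y z l.+1 1 (fun_d1 (products n))) 0 0.
  by rewrite memI; apply: idealgen_data.
have ZK (a : 'rV_l.+1) : a *m evalmx x y z l.+1 1 (fun_d1 (products n)) = 0 ->
    exists f : 'rV_(2 + l),
      z ^+ 5 *: a = f *m evalmx x y z (2 + l) l.+1 (fun_d2 (products n)).
  have [n1|n1] := ltnP 1 n; first exact: (kill_z5 ok (z5 n1)).
  have n_1 : n = 1%N by apply/eqP; rewrite eqn_leq n1; case/andP: hn.
  by move: @l a {size_d1 ok z5 mem}; rewrite n_1; apply: (kill_z5_g1 C).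
split.
- exact: quot_local (nonunit_xyz C) I.
- exact (data_embcodepth C ok mem ZK).
- exact (data_type C ok mem ZK).
- by apply (data_class_G C ok mem ZK); case/andP: hn.
Qed.

Lemma eval3_gens :
  [/\ [seq eval3 x y z p | p <- dg_d1 products1] =
        [:: x * y ^+ 2; x * y * z; y * z ^+ 2; x ^+ 4 - y ^+ 3 * z;
            x * z ^+ 3 - y ^+ 4],
      dg_d1 products2 = dg_d1 products1 ++ [:: X ^+ 3 * Y - Z ^+ 4]%P3,
      dg_d1 products3 = dg_d1 products2 ++ [:: X ^+ 2 * Z ^+ 2]%P3,
      dg_d1 products4 = dg_d1 products3 ++ [:: X ^+ 3 * Z]%P3
    & [/\ eval3 x y z (X ^+ 3 * Y - Z ^+ 4)%P3 = x ^+ 3 * y - z ^+ 4,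
          eval3 x y z (X ^+ 2 * Z ^+ 2)%P3 = x ^+ 2 * z ^+ 2
        & eval3 x y z (X ^+ 3 * Z)%P3 = x ^+ 3 * z]].
Proof.
split=> //; last by rewrite !eval3E; split; ring.
by rewrite /= !eval3E; do 5 (congr (_ :: _); first by ring).
Qed.

End Assembly.

(** * Power series *)

Section Series.
Variable R : comNzRingType.
Implicit Types (f g : series R) (a : R).

Lemma coefsD f g n : coefs (f + g) n = coefs f n + coefs g n.
Proof. by []. Qed.

Lemma coefs_sum m (F : 'I_m -> series R) n :
  coefs (\sum_i F i) n = \sum_i coefs (F i) n.
Proof. by elim/big_rec2: _ => // i u v _ <-. Qed.

Lemma coefs_constM a f n : coefs (constS a * f) n = a * coefs f n.
Proof.
rewrite /= big_ord_recl /= subn0 big1 ?addr0 // => i _; exact: mul0r.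
Qed.

Lemma coefs_varM0 f : coefs (varS R * f) 0 = 0.
Proof. by rewrite /= big_ord1 /= mul0r. Qed.

Lemma coefs_varMS f n : coefs (varS R * f) n.+1 = coefs f n.
Proof.
rewrite /= big_ord_recl mul0r add0r big_ord_recl /= mul1r subSS subn0.
by rewrite big1 ?addr0 // => i _; rewrite mul0r.
Qed.

Definition shiftS f : series R := Series (fun n => coefs f n.+1).

Lemma shiftSD f g : shiftS (f + g) = shiftS f + shiftS g.
Proof. exact: seriesP. Qed.

Lemma shiftS_var f : shiftS (varS R * f) = f.
Proof. by apply: seriesP => n; rewrite [LHS]coefs_varMS. Qed.

Lemma shiftS_const a f : shiftS (constS a * f) = constS a * shiftS f.
Proof. by apply: seriesP => n; rewrite [LHS]coefs_constM coefs_constM. Qed.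

Lemma series_split f : f = constS (coefs f 0) + varS R * shiftS f.
Proof.
apply: seriesP => -[|n]; first by rewrite coefsD coefs_varM0 addr0.
by rewrite coefsD coefs_varMS add0r.
Qed.

Lemma constSD a b : constS (a + b) = constS a + constS b.
Proof. by apply: seriesP => -[|n] //=; rewrite addr0. Qed.

Lemma constSM a b : constS (a * b) = constS a * constS b.
Proof.
by apply: seriesP => -[|n]; rewrite coefs_constM //= mulr0.
Qed.

Lemma constS0 : constS 0 = 0 :> series R.
Proof. by apply: seriesP => -[]. Qed.

Lemma coefsXl n f m : (m < n)%N -> coefs ((varS R * f) ^+ n) m = 0.
Proof.
elim: n m => // n IHn [|m] ltmn; rewrite exprS -mulrA ?coefs_varM0 //.
rewrite coefs_varMS /= big1 // => i _.
by rewrite IHn ?mulr0 // (leq_ltn_trans (leq_subr _ _)).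
Qed.

(* The inverse of [1 - X h] is the geometric series, whose coefficient of
   index [n] is read off a partial sum. *)
Lemma series_unit f b : coefs f 0 * b = 1 -> exists g, f * g = 1.
Proof.
move=> fb1; pose u := constS b * f; pose h := - shiftS u.
have def_u : u = 1 - varS R * h.
  rewrite [LHS]series_split coefs_constM mulrC fb1 /h mulrN opprK.
  by congr (_ + _); apply: seriesP.
pose S n := \sum_(i < n) (varS R * h) ^+ i.
pose v := Series (fun n => coefs (S n.+1) n).
have vE n m : (m < n)%N -> coefs v m = coefs (S n) m.
  move=> ltmn; rewrite /= /S !coefs_sum.
  rewrite -(subnKC ltmn) big_split_ord /= [X in _ = _ + X]big1 ?addr0 // => i _.
  by rewrite coefsXl // ltnS leq_addr.
exists (constS b * v); rewrite mulrA [f * _]mulrC -/u.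
apply: seriesP => n.
have -> : coefs (u * v) n = coefs (u * S n.+1) n.
  apply: eq_bigr => i _; congr (_ * _); apply: vE.
  by rewrite ltnS leq_subr.
(* The sum telescopes: [u * S n.+1] is 1 minus the power [n.+1] of [varS R * h], which has no
   coefficient of index [n]. *)
rewrite def_u /S -opprB mulNr -subrX1 opprB.
by rewrite coefsD (_ : coefs (- _) n = 0) ?addr0 //= coefsXl ?oppr0.
Qed.

End Series.

Definition mapS (R : comNzRingType) (t : R -> R) (f : series R) : series R :=
  Series (fun n => t (coefs f n)).

Section MapSeries.
Variables (R : comNzRingType) (t : R -> R).
Implicit Type f : series R.

Lemma mapSD : {morph t : a b / a + b} -> {morph mapS t : f g / f + g}.
Proof. by move=> tD f g; apply: seriesP => n /=; rewrite tD. Qed.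

Lemma mapS_const (c : R) f :
  (forall a, t (c * a) = c * t a) ->
  mapS t (constS c * f) = constS c * mapS t f.
Proof.
move=> tc; apply: seriesP => n.
by rewrite -[LHS]/(t (coefs (constS c * f) n)) !coefs_constM tc.
Qed.

Lemma mapS_constK (c : R) f :
  (forall a, t (c * a) = a) -> mapS t (constS c * f) = f.
Proof.
move=> tc; apply: seriesP => n.
by rewrite -[LHS]/(t (coefs (constS c * f) n)) coefs_constM tc.
Qed.

Lemma mapS_var f : {morph t : a b / a + b} ->
  mapS t (varS R * f) = varS R * mapS t f.
Proof.
move=> tD; have t0 : t 0 = 0 by apply: (addIr (t 0)); rewrite -tD !add0r.
apply: seriesP => -[|n]; first by rewrite coefs_varM0 -[RHS]t0 -(coefs_varM0 f).
by rewrite coefs_varMS -[LHS]/(t (coefs (varS R * f) n.+1)) coefs_varMS.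
Qed.

End MapSeries.

Section PowerSeries3.
Variable k : fieldType.
Local Notation Q := (Q k).
Local Notation x := (x k).
Local Notation y := (y k).
Local Notation z := (z k).
Implicit Types q r : Q.

(** [x] is the innermost variable and [z] the outermost, so the quotient by [x] acts two layers of
    coefficients down. *)
Definition shift_x : Q -> Q := mapS (mapS (@shiftS k)).
Definition shift_y : Q -> Q := mapS (@shiftS (series k)).
Definition shift_z : Q -> Q := @shiftS (series (series k)).

Lemma shift_xD : {morph shift_x : q r / q + r}.
Proof. by apply/mapSD/mapSD/shiftSD. Qed.
Lemma shift_yD : {morph shift_y : q r / q + r}.
Proof. by apply/mapSD/shiftSD. Qed.
Lemma shift_zD : {morph shift_z : q r / q + r}.
Proof. exact: shiftSD. Qed.

Lemma shift_xK q : shift_x (x * q) = q.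
Proof.
by apply: mapS_constK => a; apply: mapS_constK => b; apply: shiftS_var.
Qed.
Lemma shift_xy q : shift_x (y * q) = y * shift_x q.
Proof. by apply: mapS_const => a; apply: mapS_var; apply: shiftSD. Qed.
Lemma shift_xz q : shift_x (z * q) = z * shift_x q.
Proof. by apply: mapS_var; apply/mapSD/shiftSD. Qed.

Lemma shift_yx q : shift_y (x * q) = x * shift_y q.
Proof. by apply: mapS_const => a; apply: shiftS_const. Qed.
Lemma shift_yK q : shift_y (y * q) = q.
Proof. by apply: mapS_constK => a; apply: shiftS_var. Qed.
Lemma shift_yz q : shift_y (z * q) = z * shift_y q.
Proof. by apply: mapS_var; apply: shiftSD. Qed.

Lemma shift_zx q : shift_z (x * q) = x * shift_z q.
Proof. exact: shiftS_const. Qed.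
Lemma shift_zy q : shift_z (y * q) = y * shift_z q.
Proof. exact: shiftS_const. Qed.
Lemma shift_zK q : shift_z (z * q) = q.
Proof. exact: shiftS_var. Qed.

(** The variables are split off from the outside in: [z] from [q], [y] from its coefficient of index
    0, then [x]. *)
Lemma const_term0 q :
  const_term q = 0 -> exists a b c, q = x * a + y * b + z * c.
Proof.
move=> q0; set u := coefs q 0; set v := coefs u 0.
exists (constS (constS (shiftS v))), (constS (shiftS u)), (shiftS q).
rewrite [LHS]series_split -/u; congr (_ + _).
rewrite [u in LHS]series_split -/v constSD constSM; congr (_ + _).
have v0 : coefs v 0 = 0 := q0.
by rewrite [v in LHS]series_split v0 constS0 add0r !constSM.
Qed.

Lemma const_termD q r : const_term (q + r) = const_term q + const_term r.
Proof. by []. Qed.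

Lemma const_termM q r : const_term (q * r) = const_term q * const_term r.
Proof. exact: (rmorphM (@const_term k)). Qed.

Lemma nonunitE q : nonunit q <-> const_term q = 0.
Proof.
split=> [nu|q0 [b /(congr1 (@const_term k))/eqP]]; last first.
  by rewrite const_termM q0 mul0r eq_sym [_ == _]oner_eq0.
apply/eqP/negP => /negP q0; apply: nu.
(* The inverse of the constant term is lifted to [k[[x]]], to [k[[x]][[y]]] and to [Q], one variable
   at a time. *)
have [g0 g0P] := series_unit (divff q0).
have [g1 g1P] := series_unit g0P.
exact: series_unit g1P.
Qed.

Lemma nonunitP q : nonunit q <-> exists a b c, q = x * a + y * b + z * c.
Proof.
split=> [/nonunitE/const_term0 //|[a [b [c ->]]]]; apply/nonunitE.
have [x0 y0 z0] : [/\ const_term x = 0, const_term y = 0 & const_term z = 0]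
  by [].
by rewrite !const_termD !const_termM x0 y0 z0 !mul0r !addr0.
Qed.

End PowerSeries3.

Definition series_coordinates (k : fieldType) :
  coordinates k (x k) (y k) (z k) :=
  @Coordinates k (Q k) (x k) (y k) (z k) (@const_term k)
    (@nonunitE k) (@nonunitP k) _ _ _
    (@shift_xD k) (@shift_yD k) (@shift_zD k)
    (@shift_xK k) (@shift_xy k) (@shift_xz k)
    (@shift_yx k) (@shift_yK k) (@shift_yz k)
    (@shift_zx k) (@shift_zy k) (@shift_zK k).

Lemma eval3_gens_series (k : fieldType) (n : nat) : (0 < n <= 4)%N ->
  [seq eval3 (x k) (y k) (z k) p | p <- dg_d1 (products n)] = gens k n.
Proof.
have [e1 e2 e3 e4 [e5 e6 e7]] := eval3_gens (x k) (y k) (z k).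
case: n => [|[|[|[|[|//]]]]] // _; rewrite [products _]/=.
- by rewrite e2 map_cat e1 [map _ [:: _]]/= e5.
- by rewrite e3 map_cat e2 map_cat e1 [map _ [:: _]]/= e5 [map _ [:: _]]/= e6.
- by rewrite e4 map_cat e3 map_cat e2 map_cat e1 [map _ [:: _]]/= e5
    [map _ [:: _]]/= e6 [map _ [:: _]]/= e7.
Qed.

Theorem theoremI (k : fieldType) (n : nat) (hn : (1 <= n <= 4)%N) :
  [/\ local_ring (quot_g k n), embcodepth (quot_g k n) 3,
      has_type (quot_g k n) 2 & class_G (ideal_g k n) n.+1].
Proof.
apply: (ideal_data (series_coordinates k) hn) => q.
by rewrite eval3_gens_series //; split=> [/asboolP|qI]; last exact/asboolP.
Qed.
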